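(* Let $\mathcal{M}$ be a tree (as an $\mathcal{L}_t$-structure) that is either finite, or infinite with $\aleph_0$-categorical complete theory $T=\mathrm{Th}(\mathcal{M})$. Then there is a tree plan $(\Gamma,\lambda)$ such that $\mathrm{Th}(\mathcal{M})=\mathrm{Th}(\Gamma(\omega)\restriction\mathcal{L}_t)$.
   Context: Trees: the language $\mathcal{L}_t$ has a binary relation $\le$, a constant $\varepsilon$, a binary function $\sqcap$ and a unary function $\mathtt{pred}$. A tree is an $\mathcal{L}_t$-structure in which $\le$ is a partial order with every downset $\{a:a\le b\}$ well-ordered, $\varepsilon$ is the least element, $a\sqcap a'$ is the greatest common lower bound of $a,a'$, $\mathtt{pred}(a)$ is the greatest element strictly below $a$ for $a\ne\varepsilon$, and $\mathtt{pred}(\varepsilon)=\varepsilon$. Tree plans: a tree plan is a pair $(\Gamma,\lambda)$ where $\Gamma\subseteq\omega^{<\omega}$ is a finite set of finite sequences containing the empty sequence $\langle\rangle$ and closed under initial segments, and $\lambda:\Gamma\to\{1,\infty\}$ with $\lambda(\langle\rangle)=1$. $\Gamma(\omega)$ is the set of finite sequences $\langle(i_0,t_0),\dots,(i_n,t_n)\rangle$ (including the empty one) such that $\langle i_0,\dots,i_n\rangle\in\Gamma$ and for each $k\le n$: $t_k=\star$ (a fixed symbol not in $\omega$) if $\lambda(\langle i_0,\dots,i_k\rangle)=1$, and $t_k\in\omega$ if $\lambda(\langle i_0,\dots,i_k\rangle)=\infty$. $\Gamma(\omega)\restriction\mathcal{L}_t$ is the tree on this set with the initial-segment order, root the empty sequence,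 meet the longest common initial segment, and $\mathtt{pred}$ deleting the last entry. *)

(* Defs.v *)
From Stdlib Require Import List Arith Lia.
Import ListNotations.

Record LtStr := mkLtStr {
  carrier : Type;
  lt_le : carrier -> carrier -> Prop;
  lt_eps : carrier;
  lt_meet : carrier -> carrier -> carrier;
  lt_pred : carrier -> carrier
}.

Definition is_tree (M : LtStr) : Prop :=
  let le := lt_le M in
  (forall a, le a a) /\
  (forall a b, le a b -> le b a -> a = b) /\
  (forall a b c, le a b -> le b c -> le a c) /\
  (forall b a a', le a b -> le a' b -> le a a' \/ le a' a) /\
  (forall b (S : carrier M -> Prop), (exists a, S a /\ le a b) ->
     exists m, S m /\ le m b /\ forall a, S a -> le a b -> le m a) /\
  (forall a, le (lt_eps M) a) /\
  (forall a a', le (lt_meet M a a') a /\ le (lt_meet M a a') a' /\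
     forall c, le c a -> le c a' -> le c (lt_meet M a a')) /\
  (forall a, a <> lt_eps M ->
     (le (lt_pred M a) a /\ lt_pred M a <> a) /\
     forall c, le c a -> c <> a -> le c (lt_pred M a)) /\
  lt_pred M (lt_eps M) = lt_eps M.

Inductive term : Type :=
  | TVar : nat -> term
  | TEps : term
  | TMeet : term -> term -> term
  | TPred : term -> term.

Inductive form : Type :=
  | FLe : term -> term -> form
  | FEq : term -> term -> form
  | FFalse : form
  | FImp : form -> form -> form
  | FAll : nat -> form -> form.

Fixpoint fv_term (t : term) : list nat :=
  match t with
  | TVar n => [n]
  | TEps => []
  | TMeet t1 t2 => fv_term t1 ++ fv_term t2
  | TPred t1 => fv_term t1
  end.

Fixpoint fv_form (f : form) : list nat :=
  match f with
  | FLe t1 t2 | FEq t1 t2 => fv_term t1 ++ fv_term t2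
  | FFalse => []
  | FImp f1 f2 => fv_form f1 ++ fv_form f2
  | FAll n f1 => filter (fun m => negb (Nat.eqb m n)) (fv_form f1)
  end.

Definition sentence (f : form) : Prop := fv_form f = [].

Fixpoint eval (M : LtStr) (v : nat -> carrier M) (t : term) : carrier M :=
  match t with
  | TVar n => v n
  | TEps => lt_eps M
  | TMeet t1 t2 => lt_meet M (eval M v t1) (eval M v t2)
  | TPred t1 => lt_pred M (eval M v t1)
  end.

Definition upd {A : Type} (v : nat -> A) (n : nat) (a : A) : nat -> A :=
  fun m => if Nat.eqb m n then a else v m.

Fixpoint sat (M : LtStr) (v : nat -> carrier M) (f : form) : Prop :=
  match f with
  | FLe t1 t2 => lt_le M (eval M v t1) (eval M v t2)
  | FEq t1 t2 => eval M v t1 = eval M v t2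
  | FFalse => False
  | FImp f1 f2 => sat M v f1 -> sat M v f2
  | FAll n f1 => forall a : carrier M, sat M (upd v n a) f1
  end.

Definition models (M : LtStr) (f : form) : Prop := forall v, sat M v f.

Definition models_Th (M N : LtStr) : Prop :=
  forall f, sentence f -> models M f -> models N f.

Definition same_theory (M N : LtStr) : Prop :=
  forall f, sentence f -> (models M f <-> models N f).

Definition finite_str (M : LtStr) : Prop :=
  exists l : list (carrier M), forall a, In a l.

Definition countably_infinite (N : LtStr) : Prop :=
  exists f : nat -> carrier N,
    (forall m n, f m = f n -> m = n) /\ (forall a, exists n, f n = a).

Definition isomorphic (N1 N2 : LtStr) : Prop :=
  exists h : carrier N1 -> carrier N2,
    (forall x y, h x = h y -> x = y) /\ (forall b, exists a, h a = b) /\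
    (forall x y, lt_le N1 x y <-> lt_le N2 (h x) (h y)) /\
    h (lt_eps N1) = lt_eps N2 /\
    (forall x y, h (lt_meet N1 x y) = lt_meet N2 (h x) (h y)) /\
    (forall x, h (lt_pred N1 x) = lt_pred N2 (h x)).

Definition Th_aleph0_categorical (M : LtStr) : Prop :=
  forall N1 N2 : LtStr,
    countably_infinite N1 -> countably_infinite N2 ->
    models_Th M N1 -> models_Th M N2 -> isomorphic N1 N2.

(* lam s = false encodes lambda(s) = 1, lam s = true encodes lambda(s) = oo;
   only the values of lam on gam matter. *)
Record TreePlan := mkTreePlan {
  gam : list (list nat);
  lam : list nat -> bool;
  gam_nil : In [] gam;
  gam_prefix : forall s k, In s gam -> In (firstn k s) gam;
  lam_nil : lam [] = false
}.

(* An entry (i_k, t_k); t_k = None encodes the symbol star. *)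
Definition entry := (nat * option nat)%type.

Definition inGO (P : TreePlan) (s : list entry) : Prop :=
  In (map fst s) (gam P) /\
  forall k, k < length s ->
    (lam P (firstn (S k) (map fst s)) = false -> snd (nth k s (0, None)) = None) /\
    (lam P (firstn (S k) (map fst s)) = true -> exists n, snd (nth k s (0, None)) = Some n).

Lemma inGO_firstn P s m : inGO P s -> inGO P (firstn m s).
Proof.
  intros [H1 H2]; split.
  - rewrite <- firstn_map; apply gam_prefix; exact H1.
  - intros k Hk. rewrite length_firstn in Hk.
    rewrite <- firstn_map, firstn_firstn, nth_firstn.
    replace (Nat.min (S k) m) with (S k) by lia.
    replace (Nat.ltb k m) with true by (symmetry; apply Nat.ltb_lt; lia).
    apply H2; lia.
Qed.

Definition entry_eq_dec (x y : entry) : {x = y} + {x <> y}.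
Proof. repeat decide equality. Defined.

Fixpoint lcp (s t : list entry) : list entry :=
  match s, t with
  | x :: s', y :: t' => if entry_eq_dec x y then x :: lcp s' t' else []
  | _, _ => []
  end.

Lemma lcp_firstn s t : lcp s t = firstn (length (lcp s t)) s.
Proof.
  revert t; induction s as [|x s IH]; intros [|y t]; simpl; auto.
  destruct (entry_eq_dec x y); simpl; auto. f_equal. apply IH.
Qed.

Definition GO (P : TreePlan) := { s : list entry | inGO P s }.

Lemma inGO_nil P : inGO P [].
Proof. split; [exact (gam_nil P) | simpl; intros k Hk; lia]. Qed.

Definition GO_eps (P : TreePlan) : GO P := exist _ [] (inGO_nil P).

(* meet = longest common initial segment lcp s t, which equals
   firstn (length (lcp s t)) s by lcp_firstn *)
Definition GO_meet (P : TreePlan) (a b : GO P) : GO P :=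
  let s := proj1_sig a in
  exist _ (firstn (length (lcp s (proj1_sig b))) s)
    (inGO_firstn P s _ (proj2_sig a)).

Definition GO_pred (P : TreePlan) (a : GO P) : GO P :=
  let s := proj1_sig a in
  exist _ (firstn (Nat.pred (length s)) s) (inGO_firstn P s _ (proj2_sig a)).

Definition GO_le (P : TreePlan) (a b : GO P) : Prop :=
  exists u, proj1_sig b = proj1_sig a ++ u.

Definition GammaOmega (P : TreePlan) : LtStr :=
  mkLtStr (GO P) (GO_le P) (GO_eps P) (GO_meet P) (GO_pred P).

(* Main.v *)
Require Import Defs.
From Stdlib Require Import List Arith Lia Classical ClassicalEpsilon ProofIrrelevance Cantor.
Import ListNotations.

(** Categoricity enters only through Ryll-Nardzewski: if M realized infinitely
    many 1-types, some type p would contain only formulas satisfied by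
    infinitely many types, so that no formula isolates p, and Henkin
    constructions would yield one countable model realizing p and another
    omitting it. Finitely many 1-types bound the height of M, and each of them is
    isolated by a formula; hence the 1-type t of a node determines, for each
    1-type t', whether the node has exactly n or infinitely many children of type
    t'. These multiplicities define a tree plan, with lambda = oo for the infinite
    ones. Two trees of finite height with the same multiplicities are elementarily
    equivalent by a back-and-forth between finite sets closed under pred, in which
    a new node is reached from its nearest ancestor already in the domain, one
    child at a time. *)

(** * Formulas *)

Definition FTrue : form := FImp FFalse FFalse.
Definition FNot (f : form) : form := FImp f FFalse.
Definition FAnd (f g : form) : form := FNot (FImp f (FNot g)).
Definition FEx (n : nat) (f : form) : form := FNot (FAll n (FNot f)).
Definition FConj (l : list form) : form := fold_right FAnd FTrue l.

Lemma sat_and M v f g : sat M v (FAnd f g) <-> sat M v f /\ sat M v g.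
Proof. simpl; tauto. Qed.

Lemma sat_ex M v n f : sat M v (FEx n f) <-> exists a, sat M (upd v n a) f.
Proof.
  simpl; split.
  - intros H; apply NNPP; intros H'; apply H; intros a Ha; apply H'; eauto.
  - intros [a Ha] H; exact (H a Ha).
Qed.

Lemma sat_FConj M v l : sat M v (FConj l) <-> forall f, In f l -> sat M v f.
Proof.
  induction l as [|g l IH]; [simpl; tauto|].
  change (FConj (g :: l)) with (FAnd g (FConj l)); rewrite sat_and, IH; simpl.
  split; [intros [H1 H2] f [<-|H]; auto | auto].
Qed.

Lemma upd_eq {A} (v : nat -> A) n a : upd v n a n = a.
Proof. unfold upd; now rewrite Nat.eqb_refl. Qed.

Lemma upd_neq {A} (v : nat -> A) n m a : m <> n -> upd v n a m = v m.
Proof. intros H; unfold upd; apply Nat.eqb_neq in H; now rewrite H. Qed.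

Lemma eval_ext M v w t :
  (forall n, In n (fv_term t) -> v n = w n) -> eval M v t = eval M w t.
Proof.
  induction t; simpl; intros H; auto.
  - rewrite IHt1, IHt2; auto; intros; apply H, in_app_iff; auto.
  - rewrite IHt; auto.
Qed.

Lemma sat_ext M f : forall v w,
  (forall n, In n (fv_form f) -> v n = w n) -> sat M v f <-> sat M w f.
Proof.
  induction f as [t1 t2|t1 t2| |f1 IH1 f2 IH2|n f IH]; simpl; intros v w H.
  1,2: rewrite (eval_ext M v w t1), (eval_ext M v w t2); [tauto| |];
    intros; apply H, in_app_iff; auto.
  - tauto.
  - rewrite (IH1 v w), (IH2 v w); [tauto| |]; intros; apply H, in_app_iff; auto.
  - enough (forall a, sat M (upd v n a) f <-> sat M (upd w n a) f) by firstorder.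
    intros a; apply IH; intros m Hm.
    destruct (Nat.eq_dec m n) as [->|Hn]; [now rewrite !upd_eq|].
    rewrite !upd_neq by auto; apply H, filter_In; split; auto.
    apply Nat.eqb_neq in Hn; now rewrite Hn.
Qed.

Lemma sat_ext_all M f v w : (forall n, v n = w n) -> sat M v f <-> sat M w f.
Proof. intros H; apply sat_ext; auto. Qed.

Definition fresh (l : list nat) : nat := S (list_max l).

Lemma fresh_gt l n : In n l -> n < fresh l.
Proof.
  intros H; unfold fresh; apply Nat.lt_succ_r.
  assert (F := proj1 (list_max_le l (list_max l)) (le_n _)).
  rewrite Forall_forall in F; auto.
Qed.

Lemma fresh_pos l : 0 < fresh l.
Proof. unfold fresh; lia. Qed.

(** * Renaming and substitution of variables *)

Fixpoint ren_term (r : nat -> nat) (t : term) : term :=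
  match t with
  | TVar n => TVar (r n)
  | TEps => TEps
  | TMeet t1 t2 => TMeet (ren_term r t1) (ren_term r t2)
  | TPred t1 => TPred (ren_term r t1)
  end.

(** The bound variable moves above the images of all free variables of the body, so nothing is
    captured even when [r] identifies variables, as the constant renamings used later do. *)
Fixpoint ren (r : nat -> nat) (f : form) : form :=
  match f with
  | FLe t1 t2 => FLe (ren_term r t1) (ren_term r t2)
  | FEq t1 t2 => FEq (ren_term r t1) (ren_term r t2)
  | FFalse => FFalse
  | FImp f1 f2 => FImp (ren r f1) (ren r f2)
  | FAll n f1 =>
      let z := fresh (map r (fv_form f1)) in FAll z (ren (upd r n z) f1)
  end.

Lemma eval_ren M v r t : eval M v (ren_term r t) = eval M (fun n => v (r n)) t.
Proof. induction t; simpl; congruence. Qed.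

Lemma sat_ren M f : forall v r, sat M v (ren r f) <-> sat M (fun n => v (r n)) f.
Proof.
  induction f as [t1 t2|t1 t2| |f1 IH1 f2 IH2|n f IH]; intros v r; cbn [ren sat].
  1,2: rewrite !eval_ren; tauto.
  - tauto.
  - rewrite IH1, IH2; tauto.
  - set (z := fresh (map r (fv_form f))).
    enough (forall a, sat M (upd v z a) (ren (upd r n z) f) <->
                      sat M (upd (fun k => v (r k)) n a) f) by firstorder.
    intros a; rewrite IH; apply sat_ext; intros m Hm.
    destruct (Nat.eq_dec m n) as [->|Hn]; [now rewrite !upd_eq|].
    rewrite (upd_neq r), (upd_neq _ n) by auto; apply upd_neq.
    assert (r m < z) by (apply fresh_gt, in_map, Hm); lia.
Qed.

Definition sub (f : form) (m z : nat) : form := ren (upd (fun k => k) m z) f.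

Lemma sat_sub M v f m z : sat M v (sub f m z) <-> sat M (upd v m (v z)) f.
Proof.
  unfold sub; rewrite sat_ren; apply sat_ext_all; intros n; unfold upd.
  destruct (Nat.eqb n m); auto.
Qed.

Lemma sat_upd_fresh M v f z a :
  ~ In z (fv_form f) -> sat M (upd v z a) f <-> sat M v f.
Proof. intros H; apply sat_ext; intros n Hn; apply upd_neq; congruence. Qed.

Definition exs (l : list nat) (f : form) : form := fold_right FEx f l.

Lemma sat_exs M l f : forall v,
  sat M v (exs l f) <-> exists w, (forall n, ~ In n l -> w n = v n) /\ sat M w f.
Proof.
  induction l as [|m l IH]; intros v.
  - simpl; split; [eauto|]. intros [w [Hw H]]; revert H; apply sat_ext_all.
    intros n; symmetry; auto.
  - change (exs (m :: l) f) with (FEx m (exs l f)); rewrite sat_ex; split.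
    + intros [a Ha]; apply IH in Ha; destruct Ha as [w [Hw H]]; exists w; split; auto.
      intros n Hn; simpl in Hn; rewrite Hw by tauto; apply upd_neq; intuition.
    + intros [w [Hw H]]; exists (w m); apply IH; exists w; split; auto.
      intros n Hn; destruct (Nat.eq_dec n m) as [->|Hm]; [now rewrite upd_eq|].
      rewrite upd_neq by auto; apply Hw; simpl; intuition.
Qed.

(** Injective coding through Cantor pairing, so that the constructions below can schedule
    requirements by the codes of formulas. *)
Fixpoint enc_term (t : term) : nat :=
  match t with
  | TVar n => to_nat (0, n)
  | TEps => to_nat (1, 0)
  | TMeet t1 t2 => to_nat (2, to_nat (enc_term t1, enc_term t2))
  | TPred t1 => to_nat (3, enc_term t1)
  end.

Fixpoint enc (f : form) : nat :=
  match f with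
  | FLe t1 t2 => to_nat (0, to_nat (enc_term t1, enc_term t2))
  | FEq t1 t2 => to_nat (1, to_nat (enc_term t1, enc_term t2))
  | FFalse => to_nat (2, 0)
  | FImp f1 f2 => to_nat (3, to_nat (enc f1, enc f2))
  | FAll n f1 => to_nat (4, to_nat (n, enc f1))
  end.


Lemma pair_code a b c d : to_nat (a, b) = to_nat (c, d) -> a = c /\ b = d.
Proof. intros H; apply to_nat_inj in H; injection H; auto. Qed.

Lemma enc_term_inj t : forall u, enc_term t = enc_term u -> t = u.
Proof.
  induction t; intros [] H; cbn [enc_term] in H; apply pair_code in H;
    destruct H as [H0 H]; try discriminate; try apply pair_code in H;
    f_equal; intuition.
Qed.

Lemma enc_inj f : forall g, enc f = enc g -> f = g.
Proof.
  induction f; intros [] H; cbn [enc] in H; apply pair_code in H;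
    destruct H as [H0 H]; try discriminate; try apply pair_code in H;
    f_equal; intuition auto using enc_term_inj.
Qed.

(** * Generic models *)

(** The Rasiowa-Sikorski argument for countably many dense sets, with formulas as conditions and
    conjunction as strengthening. It serves both the Henkin constructions and the choice of a
    nonisolated type. *)
Lemma generic_sequence (C : form -> Prop) (D : nat -> form -> Prop) (f0 : form) :
  C f0 -> (forall k f, C f -> exists g, C (FAnd f g) /\ D k g) ->
  exists s : nat -> form,
    (forall n, C (s n)) /\
    (forall n, exists g, s (S n) = FAnd (s n) g /\ D n g).
Proof.
  intros H0 HD.
  pose (X := {f | C f}).
  assert (step : forall n (x : X), {y : X | exists g,
     proj1_sig y = FAnd (proj1_sig x) g /\ D n g}).
  { intros n [f Hf]; apply constructive_indefinite_description.
    destruct (HD n f Hf) as [g [H1 H2]].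
    exists (exist _ (FAnd f g) H1); simpl; eauto. }
  pose (s := fix s n : X := match n with 0 => exist _ f0 H0
             | S k => proj1_sig (step k (s k)) end).
  exists (fun n => proj1_sig (s n)); split.
  - intros n; exact (proj2_sig (s n)).
  - intros n; exact (proj2_sig (step n (s n))).
Qed.

Lemma sequence_mono M (s : nat -> form) (D : nat -> form -> Prop) :
  (forall n, exists g, s (S n) = FAnd (s n) g /\ D n g) ->
  forall n m v, n <= m -> sat M v (s m) -> sat M v (s n).
Proof.
  intros Hs n m v H; induction H; auto.
  destruct (Hs m) as [g [-> _]]; rewrite sat_and; tauto.
Qed.

Lemma least_nat (P : nat -> Prop) :
  (exists n, P n) -> exists n, P n /\ forall m, m < n -> ~ P m.
Proof.
  intros [n Hn]; induction n as [n IH] using lt_wf_ind.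
  destruct (classic (exists m, m < n /\ P m)) as [[m [H1 H2]]|H]; [eauto|].
  exists n; split; auto; intros m H1 H2; apply H; eauto.
Qed.

(** Increasing enumeration: [g (S k)] is the least element of [P] above [g k]. An element [a] is
    reached at the first [k] with [a <= g k], by minimality of that value. *)
Lemma unbounded_countable (P : nat -> Prop) :
  (forall i, exists n, i <= n /\ P n) ->
  exists f : nat -> {n | P n},
    (forall m n, f m = f n -> m = n) /\ (forall a, exists n, f n = a).
Proof.
  intros H.
  assert (nxt : forall i, {n | (i <= n /\ P n) /\ forall m, m < n -> ~ (i <= m /\ P m)})
    by (intros i; apply constructive_indefinite_description, least_nat, H).
  pose (g := fix g k := match k with 0 => proj1_sig (nxt 0)
              | S k => proj1_sig (nxt (S (g k))) end).
  assert (gP : forall k, P (g k))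
    by (intros [|k]; simpl; [destruct (nxt 0)|destruct (nxt (S (g k)))]; simpl; tauto).
  assert (gS : forall k, g k < g (S k))
    by (intros k; simpl; destruct (nxt (S (g k))); simpl; lia).
  assert (gmono : forall k m, k < m -> g k < g m)
    by (intros k m Hkm; induction Hkm; [apply gS|specialize (gS m); lia]).
  assert (glt : forall k, k <= g k)
    by (induction k as [|k IH]; [lia|specialize (gS k); lia]).
  exists (fun k => exist _ (g k) (gP k)); split.
  - intros m n E; injection E as E.
    destruct (Nat.lt_total m n) as [L|[L|L]]; auto; apply gmono in L; lia.
  - intros [a Ha].
    destruct (least_nat (fun k => a <= g k)) as [k [Hk1 Hk2]]; [exists a; apply glt|].
    exists k; apply subset_eq_compat.
    apply Nat.le_antisymm; auto. apply Nat.nlt_ge; intros L.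
    destruct k as [|k]; simpl in L.
    + destruct (nxt 0) as [x [Hx1 Hx2]]; simpl in L; apply (Hx2 a); auto; split; auto; lia.
    + destruct (nxt (S (g k))) as [x [Hx1 Hx2]]; simpl in L; apply (Hx2 a); auto.
      split; auto. assert (~ a <= g k) by (apply Hk2; lia). lia.
Qed.

(** * Omitting and realizing a type in a countable model *)

(** Under a constant assignment every formula, whatever its free variables, becomes a property of
    one element; 1-types are expressed this way throughout. *)
Definition cst {A : Type} (a : A) : nat -> A := fun _ => a.

Section Henkin.

Variables (M : LtStr) (p : form -> Prop).

(* Free variables play the role of Henkin constants, and [p] is a type to be
   realized by the constant [0]. *)
Definition consistent (f : form) : Prop :=
  forall h, p h -> exists v, sat M v f /\ sat M (cst (v 0)) h.

Hypothesis p_inhabited : exists h, p h.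
Hypothesis p_and : forall f g, p f -> p g ->
  exists h, p h /\ forall a, sat M (cst a) h -> sat M (cst a) f /\ sat M (cst a) g.
Hypothesis M_infinite : ~ finite_str M.

(** If members [h1] and [h2] of [p] refuted the two extensions, a common strengthening in [p] would
    still be met by an assignment satisfying [f], and that assignment decides [g]. *)
Lemma consistent_split f g :
  consistent f -> consistent (FAnd f g) \/ consistent (FAnd f (FNot g)).
Proof.
  intros Hf; destruct (classic (consistent (FAnd f g))) as [|N1]; auto.
  destruct (classic (consistent (FAnd f (FNot g)))) as [|N2]; auto; exfalso.
  unfold consistent in N1, N2.
  apply not_all_ex_not in N1; destruct N1 as [h1 N1].
  apply not_all_ex_not in N2; destruct N2 as [h2 N2].
  apply imply_to_and in N1; apply imply_to_and in N2.
  destruct N1 as [P1 N1], N2 as [P2 N2].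
  destruct (p_and h1 h2 P1 P2) as [h [Ph Hh]].
  destruct (Hf h Ph) as [v [Hv1 Hv2]]; apply Hh in Hv2.
  destruct (classic (sat M v g)).
  - apply N1; exists v; rewrite sat_and; tauto.
  - apply N2; exists v; rewrite sat_and; simpl; tauto.
Qed.

(** When the universal formula cannot be added, its negation can, and a fresh variable is
    reinterpreted as a counterexample. *)
Lemma consistent_witness f m g :
  consistent f -> exists h, consistent (FAnd f h) /\
    (h = FAll m g \/ exists z, h = FNot (sub g m z)).
Proof.
  intros Hf; destruct (consistent_split f (FAll m g) Hf) as [H|H]; [eauto|].
  set (z := fresh (fv_form f ++ fv_form g)).
  exists (FNot (sub g m z)); split; [|eauto].
  assert (Hz : forall n, In n (fv_form f ++ fv_form g) -> n <> z)
    by (intros n Hn; apply fresh_gt in Hn; fold z in Hn; lia).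
  intros h Ph; destruct (H h Ph) as [v [Hv Hh]]; rewrite sat_and in Hv.
  destruct Hv as [Hv1 Hv2]; simpl in Hv2; apply not_all_ex_not in Hv2.
  destruct Hv2 as [a Ha]; exists (upd v z a); split.
  - rewrite sat_and; split.
    + apply sat_upd_fresh; auto; intros I; apply (Hz z); auto; apply in_app_iff; auto.
    + cbn [sat FNot]; rewrite sat_sub, upd_eq; intros H'; apply Ha; revert H'.
      apply sat_ext; intros n Hn; unfold upd; destruct (Nat.eqb n m); auto.
      destruct (Nat.eqb_spec n z); auto; exfalso; apply (Hz n); auto.
      apply in_app_iff; auto.
  (* A fresh variable is positive, so the value of [0], which meets [h], is left unchanged. *)
  - rewrite upd_neq; auto; unfold z; pose proof (fresh_pos (fv_form f ++ fv_form g)); lia.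
Qed.

(** This makes the model to be built infinite. As [M] is infinite, the values of the first [i]
    variables do not exhaust it, and a fresh variable can take another value. *)
Lemma consistent_new f i :
  consistent f -> exists h, consistent (FAnd f h) /\
    exists z, forall v, sat M v h -> forall j, j < i -> v z <> v j.
Proof.
  intros Hf; set (z := fresh (fv_form f ++ seq 0 i)).
  assert (Hz : forall n, In n (fv_form f ++ seq 0 i) -> n <> z)
    by (intros n Hn; apply fresh_gt in Hn; fold z in Hn; lia).
  set (h := FConj (map (fun j => FNot (FEq (TVar z) (TVar j))) (seq 0 i))).
  assert (Hh : forall v, sat M v h <-> forall j, j < i -> v z <> v j).
  { intros v; unfold h; rewrite sat_FConj; split.
    - intros H j Hj; apply (H (FNot (FEq (TVar z) (TVar j)))).
      apply in_map_iff; exists j; split; auto; apply in_seq; lia.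
    - intros H g Hg; apply in_map_iff in Hg; destruct Hg as [j [<- Hj]].
      apply in_seq in Hj; simpl; apply H; lia. }
  exists h; split; [|exists z; intros v; apply Hh].
  intros k Pk; destruct (Hf k Pk) as [v [Hv1 Hv2]].
  destruct (classic (exists a, ~ In a (map v (seq 0 i)))) as [[a Ha]|N].
  2: { destruct M_infinite; exists (map v (seq 0 i)); intros a; apply NNPP; eauto. }
  exists (upd v z a); split.
  - rewrite sat_and, Hh; split.
    + apply sat_upd_fresh; auto; intros I; apply (Hz z); auto; apply in_app_iff; auto.
    + intros j Hj; rewrite upd_eq, upd_neq.
      * intros ->; apply Ha, in_map, in_seq; lia.
      * apply Hz, in_app_iff; right; apply in_seq; lia.
  - rewrite upd_neq; auto; unfold z; pose proof (fresh_pos (fv_form f ++ seq 0 i)); lia.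
Qed.

(** Additional requirements, to be instantiated once so as to realize a type and once so as to omit
    it. *)
Variable R : nat -> form -> Prop.
Hypothesis R_dense : forall i f, consistent f -> exists h, consistent (FAnd f h) /\ R i h.

(** Stages are decoded as pairs so that each kind meets every index. Kind 0 yields completeness,
    kind 1 Henkin witnesses, kind 2 infinitely many elements, and the rest impose [R]. *)
Definition requirement (k : nat) (h : form) : Prop :=
  let (kind, i) := of_nat k in
  match kind with
  | 0 => forall f, enc f = i -> h = f \/ h = FNot f
  | 1 => forall m g, enc (FAll m g) = i -> h = FAll m g \/ exists z, h = FNot (sub g m z)
  | 2 => exists z, forall v, sat M v h -> forall j, j < i -> v z <> v j
  | _ => R i h
  end.

Lemma requirement_dense k f :
  consistent f -> exists h, consistent (FAnd f h) /\ requirement k h.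
Proof.
  intros Hf; unfold requirement; destruct (of_nat k) as [[|[|[|kind]]] i]; auto using consistent_new.
  - destruct (classic (exists g, enc g = i)) as [[g <-]|N].
    + destruct (consistent_split f g Hf) as [H|H]; [exists g|exists (FNot g)]; split; auto;
        intros f' E; apply enc_inj in E; subst; auto.
    (* When [i] codes no formula, any consistent extension will do; [R_dense] supplies one. *)
    + destruct (R_dense 0 f Hf) as [h [Hh _]]; exists h; split; auto.
      intros g Hg; destruct N; eauto.
  - destruct (classic (exists m g, enc (FAll m g) = i)) as [[m [g <-]]|N].
    + destruct (consistent_witness f m g Hf) as [h [H1 H2]]; exists h; split; auto.
      intros m' g' E; apply enc_inj in E; injection E as -> ->; auto.
    + destruct (R_dense 0 f Hf) as [h [Hh _]]; exists h; split; auto.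
      intros m g Hg; destruct N; eauto.
Qed.

(** * The term model of a generic sequence *)

Section TermModel.

Variable s : nat -> form.
Hypothesis s_consistent : forall n, consistent (s n).
Hypothesis s_step : forall n, exists g, s (S n) = FAnd (s n) g /\ requirement n g.

(** Consequence is semantic, over assignments in [M], in place of a proof calculus. Whatever holds
    in [M] under all assignments belongs to it, whence the term model satisfies the theory of
    [M]. *)
Definition thy (f : form) : Prop := exists n, forall v, sat M v (s n) -> sat M v f.

Lemma thy_and f g h : thy f -> thy g ->
  (forall v, sat M v f -> sat M v g -> sat M v h) -> thy h.
Proof.
  intros [n Hn] [m Hm] H; exists (n + m); intros v Hv; apply H.
  - apply Hn, (sequence_mono M s requirement s_step n (n + m)); auto; lia.
  - apply Hm, (sequence_mono M s requirement s_step m (n + m)); auto; lia.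
Qed.

Lemma thy_mono f h : thy f -> (forall v, sat M v f -> sat M v h) -> thy h.
Proof. intros Hf H; apply (thy_and f f); auto. Qed.

Lemma thy_valid f : (forall v, sat M v f) -> thy f.
Proof. intros H; exists 0; auto. Qed.

Lemma thy_false f : (forall v, ~ sat M v f) -> ~ thy f.
Proof.
  intros H [n Hn]; destruct p_inhabited as [h Ph].
  destruct (s_consistent n h Ph) as [v [Hv _]]; apply (H v); auto.
Qed.

Lemma thy_requirement kind i : exists h, thy h /\ requirement (to_nat (kind, i)) h.
Proof.
  destruct (s_step (to_nat (kind, i))) as [h [E Hh]]; exists h; split; auto.
  exists (S (to_nat (kind, i))); intros v; rewrite E, sat_and; tauto.
Qed.

Lemma thy_complete f : thy f \/ thy (FNot f).
Proof.
  destruct (thy_requirement 0 (enc f)) as [h [H1 H2]].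
  unfold requirement in H2; rewrite cancel_of_to in H2.
  destruct (H2 f eq_refl) as [<-|<-]; auto.
Qed.

Lemma thy_witness m g : thy (FAll m g) \/ exists z, thy (FNot (sub g m z)).
Proof.
  destruct (thy_requirement 1 (enc (FAll m g))) as [h [H1 H2]].
  unfold requirement in H2; rewrite cancel_of_to in H2.
  destruct (H2 m g eq_refl) as [->|[z ->]]; eauto.
Qed.

(** The Henkin property is applied to the formula saying that nothing equals [t], which fails in
    [M]; its counterexample variable names [t]. *)
Lemma thy_term t : exists z, thy (FEq (TVar z) t).
Proof.
  set (m := fresh (fv_term t)).
  assert (Hm : forall v : nat -> carrier M, forall a, eval M (upd v m a) t = eval M v t).
  { intros v a; apply eval_ext; intros n Hn; apply upd_neq.
    apply fresh_gt in Hn; unfold m; lia. }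
  destruct (thy_witness m (FNot (FEq (TVar m) t))) as [H|[z H]].
  - exfalso; revert H; apply thy_false; intros v H.
    apply (H (eval M v t)); simpl; rewrite upd_eq; auto.
  - exists z; apply (thy_mono _ _ H); intros v Hv; apply NNPP; intros N; apply Hv.
    rewrite sat_sub; simpl; rewrite upd_eq, Hm; exact N.
Qed.

(** The least variable of each class modulo equality in [thy] represents the class, so the quotient
    becomes a subset of the natural numbers. *)
Definition minimal (n : nat) : Prop := forall m, m < n -> ~ thy (FEq (TVar m) (TVar n)).

Lemma minimal_term t : exists n, minimal n /\ thy (FEq (TVar n) t).
Proof.
  destruct (least_nat _ (thy_term t)) as [n [H1 H2]]; exists n; split; auto.
  intros m Hm H; apply (H2 m Hm), (thy_and _ _ _ H H1); simpl; congruence.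
Qed.

Lemma minimal_unique n m : minimal n -> minimal m -> thy (FEq (TVar n) (TVar m)) -> n = m.
Proof.
  intros Hn Hm H; destruct (Nat.lt_total n m) as [L|[L|L]]; auto; exfalso.
  - exact (Hm n L H).
  - apply (Hn m L), (thy_mono _ _ H); simpl; auto.
Qed.

Definition val (t : term) : {n | minimal n} :=
  let H := constructive_indefinite_description _ (minimal_term t) in
  exist _ (proj1_sig H) (proj1 (proj2_sig H)).

Definition var_of (a : {n | minimal n}) : term := TVar (proj1_sig a).

Lemma thy_val t : thy (FEq (var_of (val t)) t).
Proof.
  unfold var_of, val; simpl.
  exact (proj2 (proj2_sig (constructive_indefinite_description _ (minimal_term t)))).
Qed.

Lemma val_eq t u : val t = val u <-> thy (FEq t u).
Proof.
  pose proof (thy_val t) as Ht; pose proof (thy_val u) as Hu; split; intros H.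
  - rewrite H in Ht; apply (thy_and _ _ _ Ht Hu); simpl; congruence.
  - assert (E : thy (FEq (var_of (val t)) (var_of (val u)))).
    { apply (thy_and (FEq (var_of (val t)) t) (FEq (var_of (val u)) t)); auto.
      - apply (thy_and _ _ _ Hu H); simpl; congruence.
      - simpl; congruence. }
    destruct (val t) as [n Hn], (val u) as [m Hm]; apply subset_eq_compat.
    apply minimal_unique; auto.
Qed.

Lemma val_var a : val (var_of a) = a.
Proof.
  pose proof (thy_val (var_of a)) as H.
  destruct (val (var_of a)) as [n Hn], a as [m Hm]; apply subset_eq_compat.
  apply minimal_unique; auto.
Qed.

Definition term_model : LtStr :=
  mkLtStr {n | minimal n} (fun a b => thy (FLe (var_of a) (var_of b))) (val TEps)
    (fun a b => val (TMeet (var_of a) (var_of b))) (fun a => val (TPred (var_of a))).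

Definition name (v : nat -> carrier term_model) (n : nat) : nat := proj1_sig (v n).

Lemma eval_term_model v t : eval term_model v t = val (ren_term (name v) t).
Proof.
  induction t; cbn [eval ren_term]; auto.
  - symmetry; apply val_var.
  - rewrite IHt1, IHt2; simpl; apply val_eq.
    apply (thy_and _ _ _ (thy_val (ren_term (name v) t1)) (thy_val (ren_term (name v) t2))).
    simpl; congruence.
  - rewrite IHt; simpl; apply val_eq, (thy_mono _ _ (thy_val (ren_term (name v) t))).
    simpl; congruence.
Qed.

(** The truth lemma: completeness of [thy] settles implication, and Henkin witnesses settle the
    quantifier. *)
Lemma sat_term_model f : forall v, sat term_model v f <-> thy (ren (name v) f).
Proof.
  induction f as [t1 t2|t1 t2| |f1 IH1 f2 IH2|n f IH]; intros v; cbn [sat ren].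
  - rewrite !eval_term_model; simpl.
    assert (E : thy (FAnd (FEq (var_of (val (ren_term (name v) t1))) (ren_term (name v) t1))
                     (FEq (var_of (val (ren_term (name v) t2))) (ren_term (name v) t2)))).
    { apply (thy_and _ _ _ (thy_val (ren_term (name v) t1)) (thy_val (ren_term (name v) t2))).
      intros; rewrite sat_and; auto. }
    split; intros H; apply (thy_and _ _ _ E H); intros w Hw; rewrite sat_and in Hw;
      simpl in *; destruct Hw as [-> ->]; auto.
  - rewrite !eval_term_model; apply val_eq.
  - split; [intros []|]; apply thy_false; intros v' [].
  - rewrite IH1, IH2; split; intros H.
    + destruct (thy_complete (ren (name v) f1)) as [H1|H1].
      * apply (thy_mono _ _ (H H1)); simpl; auto.
      * apply (thy_mono _ _ H1); simpl; tauto.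
    + intros H1; apply (thy_and _ _ _ H H1); simpl; auto.
  - set (z := fresh (map (name v) (fv_form f))).
    (* Giving [z] the value [a] after renaming [n] to the fresh [z] agrees, on the variables of [f],
       with giving [n] the value [a] directly. *)
    assert (Hz : forall m a v', m = n \/ In m (fv_form f) ->
       upd v' z a (upd (name v) n z m) = upd (fun k => v' (name v k)) n a m :> carrier M).
    { intros m a v' Hm; destruct (Nat.eq_dec m n) as [->|Hn]; [now rewrite !upd_eq|].
      rewrite (upd_neq (name v)), (upd_neq _ n) by auto; apply upd_neq.
      destruct Hm as [|Hm]; [tauto|].
      assert (name v m < z) by (apply fresh_gt, in_map, Hm); lia. }
    split; intros H.
    + destruct (thy_witness z (ren (upd (name v) n z) f)) as [|[w Hw]]; auto; exfalso.
      (* The alleged counterexample [w] names an element of the term model, at which [H] makes the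
         body true. *)
      specialize (H (val (TVar w))); apply IH in H.
      apply (thy_false FFalse); [intros v' []|].
      apply (thy_and _ (sub (ren (upd (name v) n z) f) z w) _ Hw); [|simpl; tauto].
      apply (thy_and _ _ _ H (thy_val (TVar w))).
      intros v' H1 H2; simpl in H2; rewrite sat_sub; rewrite sat_ren in *; revert H1.
      apply sat_ext; intros m Hm; rewrite Hz by auto.
      destruct (Nat.eq_dec m n) as [->|Hn].
      * unfold name; rewrite !upd_eq; auto.
      * unfold name; rewrite !upd_neq; auto.
    + intros a; apply IH; apply (thy_mono _ _ H); intros v' H'.
      specialize (H' (v' (proj1_sig a))); rewrite sat_ren in *; revert H'.
      apply sat_ext; intros m Hm; rewrite Hz by auto.
      destruct (Nat.eq_dec m n) as [->|Hn].
      * unfold name; rewrite !upd_eq; auto.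
      * unfold name; rewrite !upd_neq; auto.
Qed.

(** Minimal variables are unbounded: a variable distinct from all those below [i] has its minimal
    representative at [i] or beyond. *)
Lemma term_model_countable : countably_infinite term_model.
Proof.
  apply (unbounded_countable minimal); intros i.
  destruct (thy_requirement 2 i) as [h [H1 H2]].
  unfold requirement in H2; rewrite cancel_of_to in H2; destruct H2 as [z Hz].
  destruct (minimal_term (TVar z)) as [n [Hn1 Hn2]]; exists n; split; auto.
  apply Nat.nlt_ge; intros L; apply (thy_false FFalse); [intros v []|].
  apply (thy_and _ _ _ H1 Hn2); intros v Hv E; simpl in *; symmetry in E.
  exact (Hz v Hv n L E).
Qed.

Lemma sat_term_model_var f : thy f -> sat term_model (fun n => val (TVar n)) f.
Proof.
  intros H; apply sat_term_model.
  (* A finite conjunction in [thy] identifies each variable of [f] with its minimal representative,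
     which undoes the renaming in the truth lemma. *)
  assert (G : forall l, exists g, thy g /\ forall v : nat -> carrier M, sat M v g -> forall n, In n l ->
    v (name (fun n => val (TVar n)) n) = v n).
  { induction l as [|m l [g [Hg1 Hg2]]].
    - exists FTrue; split; [apply thy_valid; simpl; auto|intros v _ n []].
    - exists (FAnd (FEq (var_of (val (TVar m))) (TVar m)) g); split.
      + apply (thy_and _ _ _ (thy_val (TVar m)) Hg1); intros; rewrite sat_and; auto.
      + intros v Hv; rewrite sat_and in Hv; destruct Hv as [Hv1 Hv2].
        intros n [<-|Hn]; auto; apply Hg2; auto. }
  destruct (G (fv_form f)) as [g [Hg1 Hg2]].
  apply (thy_and _ _ _ H Hg1); intros v Hf Hg; rewrite sat_ren; revert Hf.
  apply sat_ext; intros n Hn; exact (Hg2 v Hg n Hn).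
Qed.

End TermModel.

(** The enumeration [e] interprets the variables. Since it is onto, a requirement imposed on each
    variable reaches every element of [N]. *)
Lemma generic_model :
  (forall h, p h -> exists a, sat M (cst a) h) ->
  exists (N : LtStr) (e : nat -> carrier N),
    countably_infinite N /\ models_Th M N /\ (forall a, exists i, e i = a) /\
    forall i, exists h, R i h /\ sat N e h.
Proof.
  intros Hp.
  destruct (generic_sequence consistent requirement FTrue) as [s [Hs1 Hs2]].
  - intros h Ph; destruct (Hp h Ph) as [a Ha]; exists (cst a); simpl; auto.
  - intros; apply requirement_dense; auto.
  - exists (term_model s Hs1 Hs2), (fun n => val s Hs1 Hs2 (TVar n)); repeat split.
    + apply term_model_countable.
    + intros f _ Hf v; apply sat_term_model, thy_valid; intros w; apply sat_ren, Hf.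
    + intros a; exists (proj1_sig a); apply val_var.
    + intros i; destruct (thy_requirement s Hs2 3 i) as [h [H1 H2]]; exists h; split.
      * unfold requirement in H2; rewrite cancel_of_to in H2; exact H2.
      * apply sat_term_model_var, H1.
Qed.

End Henkin.

(** * Categoricity bounds the number of 1-types *)

Lemma eval_isomorphism N1 N2 (h : carrier N1 -> carrier N2) :
  h (lt_eps N1) = lt_eps N2 ->
  (forall x y, h (lt_meet N1 x y) = lt_meet N2 (h x) (h y)) ->
  (forall x, h (lt_pred N1 x) = lt_pred N2 (h x)) ->
  forall v t, h (eval N1 v t) = eval N2 (fun n => h (v n)) t.
Proof. intros He Hm Hp v t; induction t; simpl; congruence. Qed.

Lemma isomorphic_sat N1 N2 : isomorphic N1 N2 ->
  exists h : carrier N1 -> carrier N2,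
    forall f v, sat N1 v f <-> sat N2 (fun n => h (v n)) f.
Proof.
  intros [h [Hinj [Hsurj [Hle [He [Hm Hp]]]]]]; exists h.
  pose proof (eval_isomorphism N1 N2 h He Hm Hp) as E.
  induction f as [t1 t2|t1 t2| |f1 IH1 f2 IH2|n f IH]; simpl; intros v.
  - rewrite <- !E; auto.
  - rewrite <- !E; split; [congruence|auto].
  - tauto.
  - rewrite IH1, IH2; tauto.
  - assert (U : forall a, sat N1 (upd v n a) f <-> sat N2 (upd (fun k => h (v k)) n (h a)) f).
    { intros a; rewrite IH; apply sat_ext_all; intros m; unfold upd.
      destruct (Nat.eqb m n); auto. }
    split.
    + intros H b; destruct (Hsurj b) as [a <-]; apply U, H.
    + intros H a; apply U, H.
Qed.

Definition sametype (M : LtStr) (a b : carrier M) : Prop :=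
  forall f, sat M (cst a) f <-> sat M (cst b) f.

Lemma not_sametype M a b : ~ sametype M a b ->
  exists f, sat M (cst a) f /\ ~ sat M (cst b) f.
Proof.
  intros H; apply not_all_ex_not in H; destruct H as [f H].
  destruct (classic (sat M (cst a) f)); [exists f; tauto|exists (FNot f); simpl; tauto].
Qed.

Definition finitely_many_types (M : LtStr) (f : form) : Prop :=
  exists l, forall a, sat M (cst a) f -> exists b, In b l /\ sametype M a b.

Lemma finitely_many_types_split M f g :
  finitely_many_types M (FAnd f g) -> finitely_many_types M (FAnd f (FNot g)) ->
  finitely_many_types M f.
Proof.
  intros [l1 H1] [l2 H2]; exists (l1 ++ l2); intros a Ha.
  destruct (classic (sat M (cst a) g)) as [H|H]; [destruct (H1 a) as [b Hb]|destruct (H2 a) as [b Hb]];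
    rewrite ?sat_and; auto; exists b; rewrite in_app_iff; tauto.
Qed.

(** Formulas are decided one after another, always keeping a half on which infinitely many types
    remain. The result is a complete type, not necessarily realized in [M]. *)
Lemma exists_nonisolated_type M : ~ finitely_many_types M FTrue ->
  exists p : form -> Prop,
    (forall f, p f -> ~ finitely_many_types M f) /\
    (forall f, p f \/ p (FNot f)) /\
    (forall f g, p f -> p g -> p (FAnd f g)).
Proof.
  intros H.
  destruct (generic_sequence (fun f => ~ finitely_many_types M f)
    (fun k g => forall f, enc f = k -> g = f \/ g = FNot f) FTrue H) as [s [Hs1 Hs2]].
  { intros k f Hf; destruct (classic (exists g, enc g = k)) as [[g <-]|N].
    - destruct (classic (finitely_many_types M (FAnd f g))) as [H1|H1].
      + exists (FNot g); split.
        * intros H2; apply Hf, (finitely_many_types_split M f g); auto.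
        * intros f' E; apply enc_inj in E; subst; auto.
      + exists g; split; auto; intros f' E; apply enc_inj in E; subst; auto.
    - exists FTrue; split.
      + intros [l Hl]; apply Hf; exists l; intros a Ha; apply Hl; rewrite sat_and; simpl; auto.
      + intros g Hg; destruct N; eauto. }
  exists (fun f => exists n, forall a, sat M (cst a) (s n) -> sat M (cst a) f).
  repeat split.
  - intros f [n Hn] [l Hl]; apply (Hs1 n); exists l; auto.
  - intros f; destruct (Hs2 (enc f)) as [g [E Hg]].
    destruct (Hg f eq_refl) as [->| ->]; [left|right]; exists (S (enc f)); intros a;
      rewrite E, sat_and; tauto.
  - intros f g [n Hn] [m Hm]; exists (n + m); intros a Ha; apply sat_and; split.
    + apply Hn, (sequence_mono M s _ Hs2 n (n + m)); auto; lia.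
    + apply Hm, (sequence_mono M s _ Hs2 m (n + m)); auto; lia.
Qed.

(** * Models realizing and omitting a nonisolated type *)

Section NonisolatedType.

Variables (M : LtStr) (p : form -> Prop).
Hypothesis M_infinite : ~ finite_str M.
Hypothesis p_big : forall f, p f -> ~ finitely_many_types M f.
Hypothesis p_complete : forall f, p f \/ p (FNot f).
Hypothesis p_and : forall f g, p f -> p g -> p (FAnd f g).

Lemma type_true : p FTrue.
Proof.
  destruct (p_complete FTrue) as [H|H]; auto; exfalso.
  apply (p_big _ H); exists []; intros a Ha; destruct Ha; simpl; auto.
Qed.

Lemma type_realized f : p f -> exists a, sat M (cst a) f.
Proof.
  intros H; apply NNPP; intros N; apply (p_big _ H); exists []; intros a Ha.
  destruct N; eauto.
Qed.

(** The requirements put each formula of [p] on the variable [0]. They are dense because consistency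
    is tested against all members of [p], in particular against the conjunction of the new formula
    with any given one. *)
Lemma realizing_model : exists N : LtStr, countably_infinite N /\ models_Th M N /\
  exists a, forall f, p f -> sat N (cst a) f.
Proof.
  destruct (generic_model M p) with
    (R := fun i h => forall f, enc f = i -> p f -> h = ren (fun _ => 0) f)
    as [N [e [H1 [H2 [_ H3]]]]].
  - exists FTrue; apply type_true.
  - intros f g Hf Hg; exists (FAnd f g); split; auto; intros a; rewrite sat_and; auto.
  - auto.
  - intros i f Hf; destruct (classic (exists g, enc g = i /\ p g)) as [[g [<- Pg]]|Ng].
    + exists (ren (fun _ => 0) g); split.
      * intros h Ph; destruct (Hf (FAnd g h)) as [v [Hv1 Hv2]]; auto.
        rewrite sat_and in Hv2; exists v; rewrite sat_and, sat_ren; tauto.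
      * intros f' E _; apply enc_inj in E; congruence.
    + exists FTrue; split.
      * intros h Ph; destruct (Hf h Ph) as [v Hv]; exists v; rewrite sat_and; simpl; tauto.
      * intros g E Pg; destruct Ng; eauto.
  - apply type_realized.
  - exists N; split; [|split]; auto; exists (e 0); intros f Pf.
    destruct (H3 (enc f)) as [h [Hh1 Hh2]]; rewrite (Hh1 f eq_refl Pf) in Hh2.
    rewrite sat_ren in Hh2; exact Hh2.
Qed.

(* If [f] forced [p] at the variable [i], its projection to that variable would
   be a formula of [p] isolating [p]. *)
Lemma type_omitted_at i f v : sat M v f ->
  exists g w, p g /\ sat M w f /\ ~ sat M (cst (w i)) g.
Proof.
  intros Hv; apply NNPP; intros N.
  assert (F : forall g w, p g -> sat M w f -> sat M (cst (w i)) g).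
  { intros g w Pg Hw; apply NNPP; intros H; apply N; exists g, w; auto. }
  set (l := filter (fun n => negb (Nat.eqb n i)) (fv_form f)).
  assert (Hl : forall n, In n l <-> In n (fv_form f) /\ n <> i).
  { intros n; unfold l; rewrite filter_In, Bool.negb_true_iff, Nat.eqb_neq; tauto. }
  assert (X : forall a, sat M (cst a) (exs l f) <-> exists w, w i = a /\ sat M w f).
  { intros a; rewrite sat_exs; split; intros [w [Hw1 Hw2]].
    - exists w; split; auto; apply Hw1; rewrite Hl; tauto.
    - exists (fun n => if in_dec Nat.eq_dec n l then w n else a); split.
      + intros n Hn; destruct (in_dec Nat.eq_dec n l); [tauto|auto].
      + revert Hw2; apply sat_ext; intros n Hn; destruct (in_dec Nat.eq_dec n l) as [|Hn']; auto.
        rewrite Hl in Hn'; destruct (Nat.eq_dec n i) as [->|]; [auto|tauto]. }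
  destruct (p_complete (exs l f)) as [P|P].
  (* If [p] contained the negated projection, [F] would force it at [v i], where [v] witnesses the
     projection itself. *)
  2: { apply (F _ v P Hv); apply X; eauto. }
  (* Otherwise the projection lies in [p], yet all its solutions have the type of [v i]: a formula
     separating two of them is decided by [p], and [F] forces that decision at both. *)
  apply (p_big _ P); exists [v i]; intros b Hb; exists (v i); split; [left; auto|].
  apply NNPP; intros Nb; apply not_sametype in Nb; destruct Nb as [g [Hg1 Hg2]].
  apply X in Hb; destruct Hb as [w [<- Hw]].
  destruct (p_complete g) as [Pg|Pg].
  - exact (Hg2 (F g v Pg Hv)).
  - exact (F _ w Pg Hw Hg1).
Qed.

(** The construction runs with the trivial type, for which consistency is satisfiability in [M].
    Each requirement makes one variable violate some formula of [p], and variables name all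
    elements. *)
Lemma omitting_model : exists N : LtStr, countably_infinite N /\ models_Th M N /\
  forall a, exists f, p f /\ ~ sat N (cst a) f.
Proof.
  destruct (generic_model M (fun f => f = FTrue)) with
    (R := fun i h => exists f, p f /\ h = FNot (ren (fun _ => i) f))
    as [N [e [H1 [H2 [H3 H4]]]]].
  - eauto.
  - intros f g -> ->; exists FTrue; split; auto.
  - auto.
  - intros i f Hf; destruct (Hf FTrue eq_refl) as [v [Hv _]].
    destruct (type_omitted_at i f v Hv) as [g [w [Pg [Hw1 Hw2]]]].
    exists (FNot (ren (fun _ => i) g)); split; [|eauto].
    intros h ->; exists w; rewrite sat_and; split; [split; auto|simpl; auto].
    intros H; apply Hw2; rewrite sat_ren in H; exact H.
  - intros h ->; exists (lt_eps M); simpl; auto.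
  - exists N; split; [|split]; auto; intros a; destruct (H3 a) as [i <-].
    destruct (H4 i) as [h [[f [Pf ->]] Hf]]; exists f; split; auto.
    intros H; apply Hf; rewrite sat_ren; exact H.
Qed.

End NonisolatedType.

Lemma categorical_finitely_many_types M :
  ~ finite_str M -> Th_aleph0_categorical M -> finitely_many_types M FTrue.
Proof.
  intros Hinf Hcat; apply NNPP; intros N.
  destruct (exists_nonisolated_type M N) as [p [P1 [P2 P3]]].
  destruct (realizing_model M p) as [N1 [C1 [T1 [a Ha]]]]; auto.
  destruct (omitting_model M p) as [N2 [C2 [T2 H2]]]; auto.
  destruct (isomorphic_sat N1 N2 (Hcat N1 N2 C1 C2 T1 T2)) as [h Hh].
  destruct (H2 (h a)) as [f [Pf Hf]]; apply Hf.
  apply (Hh f (cst a)); auto.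
Qed.

Lemma finite_finitely_many_types M : finite_str M -> finitely_many_types M FTrue.
Proof. intros [l Hl]; exists l; intros a _; exists a; split; auto; intros f; tauto. Qed.

(** * Trees with the same child multiplicities *)

(** The root is excluded because it is its own [lt_pred]. *)
Definition child (A : LtStr) (c a : carrier A) : Prop := c <> lt_eps A /\ lt_pred A c = a.

Definition anc (A : LtStr) (n : nat) (a : carrier A) : carrier A := Nat.iter n (lt_pred A) a.

(** What the back-and-forth uses of both trees. The order is determined by [lt_pred], and each node
    has finite height, with no uniform bound. *)
Record finite_height_tree (A : LtStr) : Prop := {
  fh_antisym : forall a b, lt_le A a b -> lt_le A b a -> a = b;
  fh_le : forall a b, lt_le A a b <-> exists n, anc A n b = a;
  fh_meet : forall a b, lt_le A (lt_meet A a b) a /\ lt_le A (lt_meet A a b) b /\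
    forall c, lt_le A c a -> lt_le A c b -> lt_le A c (lt_meet A a b);
  fh_pred_eps : lt_pred A (lt_eps A) = lt_eps A;
  fh_height : forall a, exists n, anc A n a = lt_eps A
}.

Definition children_ge (A : LtStr) (ty : carrier A -> nat) (a : carrier A) (t n : nat) : Prop :=
  exists ys, length ys = n /\ NoDup ys /\ forall y, In y ys -> child A y a /\ ty y = t.

(* A multiplicity [None] stands for infinity. *)
Definition le_mult (n : nat) (m : option nat) : Prop :=
  match m with Some k => n <= k | None => True end.

(** Counting from below treats finite and infinite multiplicities alike; the count depends on the
    parent only through its type. *)
Definition has_multiplicities (A : LtStr) (ty : carrier A -> nat)
    (mult : nat -> nat -> option nat) : Prop :=
  forall a t n, children_ge A ty a t n <-> le_mult n (mult (ty a) t).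

(** A finite type-preserving partial bijection closed under [lt_pred]. In trees of finite height
    this closure forces order and meets to be respected as well. *)
Definition partial_match (A B : LtStr) (tA : carrier A -> nat) (tB : carrier B -> nat)
    (l : list (carrier A * carrier B)) : Prop :=
  In (lt_eps A, lt_eps B) l /\
  (forall a b a' b', In (a, b) l -> In (a', b') l -> (a = a' <-> b = b')) /\
  (forall a b, In (a, b) l -> In (lt_pred A a, lt_pred B b) l) /\
  (forall a b, In (a, b) l -> tA a = tB b).

Definition swap {X Y : Type} (x : X * Y) : Y * X := (snd x, fst x).

Lemma in_swap {X Y : Type} (l : list (X * Y)) a b : In (b, a) (map swap l) <-> In (a, b) l.
Proof.
  rewrite in_map_iff; split.
  - intros [[a' b'] [E H]]; unfold swap in E; injection E as -> ->; auto.
  - intros H; exists (a, b); auto.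
Qed.

Lemma partial_match_swap A B tA tB l :
  partial_match A B tA tB l -> partial_match B A tB tA (map swap l).
Proof.
  intros [H1 [H2 [H3 H4]]]; split; [|split; [|split]].
  - apply in_swap; auto.
  - intros a b a' b' I I'; rewrite in_swap in *; symmetry; eauto.
  - intros a b I; rewrite in_swap in *; auto.
  - intros a b I; rewrite in_swap in *; symmetry; auto.
Qed.

Lemma nodup_pigeonhole {X : Type} (xs ys : list X) :
  NoDup xs -> length ys < length xs -> exists x, In x xs /\ ~ In x ys.
Proof.
  intros H L; apply NNPP; intros N.
  enough (length xs <= length ys) by lia.
  apply NoDup_incl_length; auto; intros x Hx; apply NNPP; intros Hn; eauto.
Qed.

Lemma partial_match_forth A B tA tB mult l :
  finite_height_tree A -> has_multiplicities A tA mult -> has_multiplicities B tB mult ->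
  partial_match A B tA tB l ->
  forall a, exists b l', incl l l' /\ partial_match A B tA tB l' /\ In (a, b) l'.
Proof.
  intros HA mA mB Hl a; destruct (fh_height A HA a) as [n Hn]; revert a Hn.
  induction n as [|n IH]; intros a Hn.
  { simpl in Hn; subst a; exists (lt_eps B), l; split; [apply incl_refl|split; auto; apply Hl]. }
  unfold anc in Hn; rewrite Nat.iter_succ_r in Hn.
  destruct (IH (lt_pred A a) Hn) as [b1 [l1 [Hl1 [M1 I1]]]].
  destruct (classic (exists b, In (a, b) l1)) as [[b Hb]|Na]; [exists b, l1; auto|].
  pose proof M1 as [E1 [E2 [E3 E4]]].
  assert (a_ne : a <> lt_eps A) by (intros ->; eauto).
  set (dec := fun x y : carrier A * carrier B => excluded_middle_informative (x = y)).
  set (f := fun x : carrier A * carrier B =>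
    if excluded_middle_informative (child B (snd x) b1 /\ tA (fst x) = tA a) then true else false).
  (* These pairs account for the children of [b1] of the type of [a] already in use; duplicates are
     removed so that the length counts them. *)
  set (ps := filter f (nodup dec l1)).
  assert (Hps : forall c d, In (c, d) ps <-> In (c, d) l1 /\ child B d b1 /\ tA c = tA a).
  { intros c d; unfold ps, f; rewrite filter_In, nodup_In; simpl.
    destruct excluded_middle_informative; intuition congruence. }
  assert (Nps : NoDup (map fst ps)).
  { apply NoDup_map_NoDup_ForallPairs.
    - intros [c d] [c' d'] H H' E; simpl in E; subst c'; rewrite Hps in H, H'.
      f_equal; apply (E2 c d c d'); tauto.
    - apply NoDup_filter, NoDup_nodup. }
  assert (CA : children_ge A tA (lt_pred A a) (tA a) (S (length ps))).
  { exists (a :: map fst ps); split; [simpl; now rewrite length_map|split].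
    - constructor; auto; intros H; apply in_map_iff in H; destruct H as [[c d] [Ec H]].
      simpl in Ec; subst c; apply Hps in H; apply Na; exists d; tauto.
    - intros y [<-|Hy]; [split; [split|]; auto|].
      apply in_map_iff in Hy; destruct Hy as [[c d] [Ec H]]; simpl in Ec; subst c.
      apply Hps in H; destruct H as [H1 [[H2 H3] H4]]; split; auto; split.
      + intros E; apply H2, (E2 y d _ _ H1 E1), E.
      + apply (E2 _ _ _ _ (E3 _ _ H1) I1); exact H3. }
  (* With [a] itself, the predecessor of [a] has one child more of this type than there are pairs in
     [ps]; the bound passes to [b1], which has the same type. *)
  apply mA in CA; rewrite (E4 _ _ I1) in CA; apply mB in CA.
  destruct CA as [ys [Ly [Ny Hys]]].
  destruct (nodup_pigeonhole ys (map snd ps)) as [b [Hb1 Hb2]]; auto.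
  { rewrite length_map; lia. }
  destruct (Hys b Hb1) as [[Hb3 Hb4] Hb5].
  assert (Nb : forall c, ~ In (c, b) l1).
  { intros c Hc; apply Hb2, in_map_iff; exists (c, b); split; auto; apply Hps.
    rewrite (E4 _ _ Hc), Hb5; unfold child; auto. }
  exists b, ((a, b) :: l1); split; [apply incl_tl; auto|split; [|left; auto]].
  split; [right; auto|split; [|split]].
  - intros c d c' d' [I|I] [I'|I'].
    + injection I as <- <-; injection I' as <- <-; tauto.
    + injection I as <- <-; split; intros <-; [destruct Na; eauto|destruct (Nb _ I')].
    + injection I' as <- <-; split; intros ->; [destruct Na; eauto|destruct (Nb _ I)].
    + eauto.
  - intros c d [I|I]; [injection I as <- <-; right; rewrite Hb4; auto|right; auto].
  - intros c d [I|I]; [injection I as <- <-; auto|auto].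
Qed.

Section BackAndForth.

Variables (A B : LtStr) (tA : carrier A -> nat) (tB : carrier B -> nat)
  (mult : nat -> nat -> option nat).
Hypotheses (HA : finite_height_tree A) (HB : finite_height_tree B)
  (mA : has_multiplicities A tA mult) (mB : has_multiplicities B tB mult).

Lemma partial_match_anc l : partial_match A B tA tB l ->
  forall n a b, In (a, b) l -> In (anc A n a, anc B n b) l.
Proof. intros Hl n a b H; induction n; simpl; auto; apply Hl; auto. Qed.

Lemma partial_match_le l : partial_match A B tA tB l ->
  forall a b a' b', In (a, b) l -> In (a', b') l -> lt_le A a a' <-> lt_le B b b'.
Proof.
  intros Hl a b a' b' H H'; rewrite (fh_le A HA), (fh_le B HB).
  assert (E : forall n, anc A n a' = a <-> anc B n b' = b).
  { intros n; pose proof (partial_match_anc l Hl n _ _ H'); apply Hl; auto. }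
  firstorder.
Qed.

(** Each meet is an ancestor of a matched node and so has a partner. Order preservation makes the
    partner of one meet a greatest common lower bound, hence equal to the other. *)
Lemma partial_match_meet l : partial_match A B tA tB l ->
  forall a b a' b', In (a, b) l -> In (a', b') l -> In (lt_meet A a a', lt_meet B b b') l.
Proof.
  intros Hl a b a' b' H H'.
  pose proof (partial_match_le l Hl) as LE.
  destruct (fh_meet A HA a a') as [A1 [A2 A3]]; destruct (fh_meet B HB b b') as [B1 [B2 B3]].
  pose proof (proj1 (fh_le A HA _ _) A1) as [n Hn].
  pose proof (proj1 (fh_le B HB _ _) B1) as [m Hm].
  pose proof (partial_match_anc l Hl n _ _ H) as I; rewrite Hn in I.
  pose proof (partial_match_anc l Hl m _ _ H) as J; rewrite Hm in J.
  replace (lt_meet B b b') with (anc B n b); auto.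
  apply (fh_antisym B HB).
  - apply B3; [apply (LE _ _ _ _ I H)|apply (LE _ _ _ _ I H')]; auto.
  - apply (LE _ _ _ _ J I), A3; [apply (LE _ _ _ _ J H)|apply (LE _ _ _ _ J H')]; auto.
Qed.

Lemma partial_match_eval l v w : partial_match A B tA tB l ->
  forall t, (forall n, In n (fv_term t) -> In (v n, w n) l) -> In (eval A v t, eval B w t) l.
Proof.
  intros Hl; induction t; simpl; intros H; auto.
  - apply Hl.
  - apply partial_match_meet; auto; [apply IHt1|apply IHt2]; intros; apply H, in_app_iff; auto.
  - apply Hl, IHt, H.
Qed.

Lemma partial_match_back l : partial_match A B tA tB l ->
  forall b, exists a l', incl l l' /\ partial_match A B tA tB l' /\ In (a, b) l'.
Proof.
  intros Hl b; apply partial_match_swap in Hl.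
  destruct (partial_match_forth _ _ _ _ mult _ HB mB mA Hl b) as [a [l' [H1 [H2 H3]]]].
  exists a, (map swap l'); split; [|split].
  - intros [c d] H; apply in_swap, H1, in_swap, H.
  - apply partial_match_swap, H2.
  - apply in_swap, H3.
Qed.

Lemma partial_match_sat f : forall l v w, partial_match A B tA tB l ->
  (forall n, In n (fv_form f) -> In (v n, w n) l) -> sat A v f <-> sat B w f.
Proof.
  induction f as [t1 t2|t1 t2| |f1 IH1 f2 IH2|n f IH]; simpl; intros l v w Hl H.
  1,2: assert (I1 : In (eval A v t1, eval B w t1) l)
      by (apply partial_match_eval; auto; intros; apply H, in_app_iff; auto);
    assert (I2 : In (eval A v t2, eval B w t2) l)
      by (apply partial_match_eval; auto; intros; apply H, in_app_iff; auto).
  - apply (partial_match_le l); auto.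
  - apply Hl; auto.
  - tauto.
  - rewrite (IH1 l v w), (IH2 l v w); [tauto|auto| |auto|]; intros; apply H, in_app_iff; auto.
  - assert (U : forall l' a b, incl l l' -> In (a, b) l' ->
        forall m, In m (fv_form f) -> In (upd v n a m, upd w n b m) l').
    { intros l' a b Hll I m Hm; destruct (Nat.eq_dec m n) as [->|Hn]; [now rewrite !upd_eq|].
      rewrite !upd_neq by auto; apply Hll, H, filter_In; split; auto.
      apply Nat.eqb_neq in Hn; now rewrite Hn. }
    split.
    + intros S b; destruct (partial_match_back l Hl b) as [a [l' [H1 [H2 H3]]]].
      apply (IH l' (upd v n a)); auto.
    + intros S a; destruct (partial_match_forth _ _ _ _ mult l HA mA mB Hl a) as [b [l' [H1 [H2 H3]]]].
      apply (IH l' _ (upd w n b)); auto.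
Qed.

Lemma same_multiplicities_same_theory : tA (lt_eps A) = tB (lt_eps B) -> same_theory A B.
Proof.
  intros He f Hf.
  assert (S : forall v w, sat A v f <-> sat B w f).
  { intros v w; apply (partial_match_sat f [(lt_eps A, lt_eps B)]).
    - split; [left; auto|split; [|split]].
      + intros a b a' b' [E|[]] [E'|[]]; injection E as <- <-; injection E' as <- <-; tauto.
      + intros a b [E|[]]; injection E as <- <-; left.
        now rewrite (fh_pred_eps A HA), (fh_pred_eps B HB).
      + intros a b [E|[]]; injection E as <- <-; auto.
    - rewrite Hf; intros n []. }
  split; intros H v.
  - apply (S (cst (lt_eps A))), H.
  - apply (S _ (cst (lt_eps B))), H.
Qed.

End BackAndForth.

(** * Multiplicities from finitely many 1-types *)

(** A minimal node from which [lt_pred] never reaches the root would have a smaller predecessor of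
    the same kind. With heights finite, induction on height recovers the order from [lt_pred]. *)
Lemma tree_finite_height M : is_tree M -> finite_height_tree M.
Proof.
  intros [Hr [Ha [Ht [_ [Hw [He [Hm [Hp Hpe]]]]]]]].
  assert (height : forall a, exists n, anc M n a = lt_eps M).
  { intros a; apply NNPP; intros Na.
    destruct (Hw a (fun x => ~ exists n, anc M n x = lt_eps M)) as [m [H1 [H2 H3]]]; eauto.
    assert (m_ne : m <> lt_eps M) by (intros ->; apply H1; exists 0; auto).
    destruct (Hp m m_ne) as [[P1 P2] _]; apply P2, Ha; auto; apply H3; [|eauto].
    intros [n Hn]; apply H1; exists (S n); unfold anc; rewrite Nat.iter_succ_r; auto. }
  split; auto.
  intros a b; split.
  - destruct (height b) as [n Hn]; revert b Hn; induction n as [|n IH]; intros b Hn Hab.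
    + exists 0; simpl in *; subst b; auto.
    + destruct (classic (a = b)) as [->|N]; [exists 0; auto|].
      assert (b <> lt_eps M) by (intros ->; apply N, Ha; auto).
      unfold anc in Hn; rewrite Nat.iter_succ_r in Hn.
      destruct (IH (lt_pred M b) Hn) as [k Hk]; [apply Hp; auto|].
      exists (S k); unfold anc; rewrite Nat.iter_succ_r; auto.
  - intros [n <-]; induction n as [|n IH]; [apply Hr|].
    apply Ht with (anc M n b); auto; simpl; fold (anc M n b).
    destruct (classic (anc M n b = lt_eps M)) as [->|N]; [rewrite Hpe; auto|apply Hp; auto].
Qed.

Lemma anc_eps M n : lt_pred M (lt_eps M) = lt_eps M -> anc M n (lt_eps M) = lt_eps M.
Proof. intros H; unfold anc; induction n; simpl; congruence. Qed.

Lemma eval_iter_pred M v n t : eval M v (Nat.iter n TPred t) = anc M n (eval M v t).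
Proof. unfold anc; induction n; simpl; congruence. Qed.

(** Reaching the root in [H] steps is a first-order property, so it suffices to check
    representatives of the types; [H] is a sum of bounds on their heights. *)
Lemma finitely_many_types_bounded_height M :
  finite_height_tree M -> finitely_many_types M FTrue ->
  exists H, forall a, anc M H a = lt_eps M.
Proof.
  intros HM [l Hl].
  assert (B : exists H, forall b, In b l -> anc M H b = lt_eps M).
  { clear Hl; induction l as [|b l [H IH]]; [exists 0; intros b []|].
    destruct (fh_height M HM b) as [n Hn]; exists (n + H); intros c [<-|Hc]; unfold anc.
    - rewrite Nat.add_comm, Nat.iter_add; unfold anc in Hn; rewrite Hn.
      apply anc_eps, (fh_pred_eps M HM).
    - rewrite Nat.iter_add; fold (anc M H c); rewrite IH by auto.
      apply anc_eps, (fh_pred_eps M HM). }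
  destruct B as [H HB]; exists H; intros a.
  destruct (Hl a) as [b [Hb1 Hb2]]; [simpl; auto|].
  specialize (Hb2 (FEq (Nat.iter H TPred (TVar 0)) TEps)); cbn [sat] in Hb2.
  rewrite !eval_iter_pred in Hb2; apply Hb2, HB, Hb1.
Qed.

(** Conjoin, over the finitely many representatives of other types, a formula true at [b] and false
    at the representative. *)
Lemma isolating_formula M : finitely_many_types M FTrue ->
  forall b, exists f, forall a, sat M (cst a) f <-> sametype M a b.
Proof.
  intros [l Hl] b.
  assert (I : exists f, sat M (cst b) f /\ forall c, In c l -> sat M (cst c) f -> sametype M c b).
  { clear Hl; induction l as [|c l [f [H1 H2]]]; [exists FTrue; simpl; tauto|].
    destruct (classic (sametype M c b)) as [E|N].
    - exists f; split; auto; intros d [<-|Hd]; auto.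
    - assert (G : exists g, sat M (cst b) g /\ ~ sat M (cst c) g)
        by (apply not_sametype; intros S; apply N; intros g; symmetry; apply S).
      destruct G as [g [G1 G2]]; exists (FAnd f g); rewrite sat_and; split; auto.
      intros d [<-|Hd]; rewrite sat_and; [tauto|intros [Hf _]; auto]. }
  destruct I as [f [H1 H2]]; exists f; intros a; split.
  - intros Ha; destruct (Hl a) as [c [Hc1 Hc2]]; [simpl; auto|].
    intros g; rewrite (Hc2 g); apply H2; auto; apply Hc2; auto.
  - intros S; apply S; auto.
Qed.

(** A type is numbered by the first position at which it is represented in the list. *)
Lemma type_index M : finitely_many_types M FTrue ->
  exists (ty : carrier M -> nat) (K : nat),
    (forall a, ty a < K) /\ (forall a b, ty a = ty b <-> sametype M a b).
Proof.
  intros [l Hl]; set (P := fun a n => n < length l /\ sametype M a (nth n l (lt_eps M))).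
  assert (T : forall a, {n | P a n /\ forall m, m < n -> ~ P a m}).
  { intros a; apply constructive_indefinite_description, least_nat.
    destruct (Hl a) as [b [Hb1 Hb2]]; [simpl; auto|].
    apply (In_nth _ _ (lt_eps M)) in Hb1; destruct Hb1 as [n [H1 H2]]; exists n; split; auto.
    now rewrite H2. }
  exists (fun a => proj1_sig (T a)), (length l); split.
  - intros a; destruct (T a) as [n [[Hn ?] ?]]; auto.
  - intros a b; destruct (T a) as [n [[Hn1 Hn2] Hn3]], (T b) as [m [[Hm1 Hm2] Hm3]]; simpl; split.
    + intros <- f; rewrite (Hn2 f), (Hm2 f); tauto.
    + intros S; destruct (Nat.lt_total n m) as [L|[L|L]]; auto; exfalso.
      * apply (Hm3 n L); split; auto; intros f; rewrite <- (S f); apply Hn2.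
      * apply (Hn3 m L); split; auto; intros f; rewrite (S f); apply Hm2.
Qed.

(* [x_0] is the parent and [x_1, ..., x_k] are the children chosen so far. *)
Fixpoint at_least (f : form) (n k : nat) : form :=
  match n with
  | 0 => FTrue
  | S n =>
      FEx (S k) (FConj
        [FNot (FEq (TVar (S k)) TEps); FEq (TPred (TVar (S k))) (TVar 0);
         ren (fun _ => S k) f;
         FConj (map (fun j => FNot (FEq (TVar (S k)) (TVar j))) (seq 1 k));
         at_least f n (S k)])
  end.

(** Avoiding the values of variables [1] to [k] carries the induction; at [k = 0] the condition is
    vacuous and pure counting remains. *)
Lemma sat_at_least M f n : forall k v,
  sat M v (at_least f n k) <->
  exists ys, length ys = n /\ NoDup ys /\ forall y, In y ys ->
    (child M y (v 0) /\ sat M (cst y) f) /\ forall j, 1 <= j <= k -> y <> v j.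
Proof.
  induction n as [|n IH]; intros k v.
  - simpl; split; [|tauto]; intros _; exists []; split; [|split]; auto; [constructor|intros y []].
  - cbn [at_least]; rewrite sat_ex.
    assert (E : forall a, sat M (upd v (S k) a) (FConj
        [FNot (FEq (TVar (S k)) TEps); FEq (TPred (TVar (S k))) (TVar 0);
         ren (fun _ => S k) f;
         FConj (map (fun j => FNot (FEq (TVar (S k)) (TVar j))) (seq 1 k));
         at_least f n (S k)]) <->
      ((child M a (v 0) /\ sat M (cst a) f) /\ (forall j, 1 <= j <= k -> a <> v j)) /\
      sat M (upd v (S k) a) (at_least f n (S k))).
    { intros a; unfold FConj at 1; cbn [fold_right].
      rewrite !sat_and, sat_ren, sat_FConj, !upd_eq.
      assert (D : (forall g, In g (map (fun j => FNot (FEq (TVar (S k)) (TVar j))) (seq 1 k)) ->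
                     sat M (upd v (S k) a) g) <-> forall j, 1 <= j <= k -> a <> v j).
      { split.
        - intros H j Hj; specialize (H (FNot (FEq (TVar (S k)) (TVar j)))).
          simpl in H; rewrite upd_eq, upd_neq in H by lia.
          intros Ej; apply H; auto; apply in_map_iff; exists j; split; auto; apply in_seq; lia.
        - intros H g Hg; apply in_map_iff in Hg; destruct Hg as [j [<- Hj]].
          apply in_seq in Hj; simpl; rewrite upd_eq, upd_neq by lia; apply H; lia. }
      rewrite D; unfold child; change (fun _ : nat => a) with (cst a).
      simpl; rewrite upd_eq, upd_neq by lia; unfold FTrue; simpl; tauto. }
    split.
    + intros [a Ha]; apply E in Ha; destruct Ha as [H1 H2]; apply IH in H2.
      destruct H2 as [ys [L [N H2]]]; rewrite upd_neq in H2 by lia.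
      exists (a :: ys); split; [simpl; lia|split].
      * constructor; auto; intros Hy; destruct (H2 a Hy) as [_ H3].
        apply (H3 (S k)); [lia|now rewrite upd_eq].
      * intros y [<-|Hy]; auto; destruct (H2 y Hy) as [H3 H4]; split; auto.
        intros j Hj; rewrite <- (upd_neq v (S k) j a) by lia; apply H4; lia.
    + intros [[|a ys] [L [N H]]]; [discriminate|]; exists a; apply E; split; [apply H; left; auto|].
      apply IH; exists ys; inversion N as [|? ? N1 N2]; subst.
      split; [simpl in L; lia|split; auto]; intros y Hy; rewrite upd_neq by lia.
      destruct (H y) as [H1 H2]; [right; auto|split; auto]; intros j Hj.
      destruct (Nat.eq_dec j (S k)) as [->|Hn].
      * rewrite upd_eq; intros ->; auto.
      * rewrite upd_neq by auto; apply H2; lia.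
Qed.

Lemma children_ge_le M ty a t n m : n <= m -> children_ge M ty a t m -> children_ge M ty a t n.
Proof.
  intros L [ys [L1 [N H]]]; exists (firstn n ys); split; [rewrite length_firstn; lia|split].
  - rewrite <- (firstn_skipn n ys) in N; apply NoDup_app_remove_r in N; auto.
  - intros y Hy; apply H; rewrite <- (firstn_skipn n ys); apply in_app_iff; auto.
Qed.

Lemma children_ge_mult M ty a t :
  exists m, forall n, children_ge M ty a t n <-> le_mult n m.
Proof.
  destruct (classic (forall n, children_ge M ty a t n)) as [H|H].
  - exists None; intros n; simpl; split; auto.
  (* Having at least 0 children always holds, so the least failing number is some [S k] and the
     multiplicity is [k]. *)
  - apply not_all_ex_not, least_nat in H; destruct H as [[|k] [H1 H2]].
    + destruct H1; exists []; split; [|split]; auto; [constructor|intros y []].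
    + exists (Some k); intros n; simpl; split.
      * intros Hn; apply Nat.nlt_ge; intros L; apply H1, (children_ge_le _ _ _ _ _ n); auto.
      * intros L; apply (children_ge_le _ _ _ _ _ k); auto; apply NNPP, H2; lia.
Qed.

Lemma finitely_many_types_multiplicities M : finitely_many_types M FTrue ->
  exists (ty : carrier M -> nat) (K : nat) (mult : nat -> nat -> option nat),
    has_multiplicities M ty mult /\ forall s t, K <= t -> mult s t = Some 0.
Proof.
  intros HF; destruct (type_index M HF) as [ty [K [HK Hty]]].
  (* Child counts depend only on the type of the parent, since [at_least] applied to an isolating
     formula of the child type expresses them. *)
  assert (inv : forall a b t n, ty a = ty b -> children_ge M ty a t n -> children_ge M ty b t n).
  { intros a b t n E H.
    destruct (classic (exists c, ty c = t)) as [[c <-]|N].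
    - destruct (isolating_formula M HF c) as [f Hf].
      assert (X : forall d, children_ge M ty d (ty c) n <-> sat M (cst d) (at_least f n 0)).
      { intros d; rewrite sat_at_least; split; intros [ys [L [Nd Hys]]]; exists ys;
          split; [auto|split; auto|auto|split; auto]; intros y Hy; specialize (Hys y Hy);
          rewrite Hf, <- Hty in *; [split; [tauto|lia]|tauto]. }
      apply X; apply X in H; apply Hty in E; apply E, H.
    - destruct H as [[|y ys] [L [Nd Hys]]].
      + subst n; exists []; split; [|split]; auto; intros y [].
      + destruct N; exists y; apply Hys; left; auto. }
  assert (Hmult : forall s t, {m | (K <= t -> m = Some 0) /\
    forall a, ty a = s -> forall n, children_ge M ty a t n <-> le_mult n m}).
  { intros s t; apply constructive_indefinite_description.
    destruct (le_lt_dec K t) as [L|L].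
    - exists (Some 0); split; auto; intros a _ n; simpl; split.
      + intros [[|y ys] [L1 [Nd Hys]]]; [simpl in L1; lia|].
        destruct (Hys y (or_introl eq_refl)) as [_ E]; specialize (HK y); lia.
      + intros Hn; exists []; split; [simpl; lia|split]; [constructor|intros y []].
    - destruct (classic (exists a, ty a = s)) as [[a <-]|N].
      + destruct (children_ge_mult M ty a t) as [m Hm]; exists m; split; [lia|].
        intros b E n; rewrite <- Hm; split; apply inv; auto.
      (* No node has type [s], so the value [None] is arbitrary. *)
      + exists None; split; [lia|]; intros a E; destruct N; eauto. }
  exists ty, K, (fun s t => proj1_sig (Hmult s t)); split.
  - intros a t n; destruct (Hmult (ty a) t) as [m [? Hm]]; simpl; auto.
  - intros s t; destruct (Hmult s t) as [m [Hm ?]]; simpl; auto.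
Qed.

(** * The tree of a tree plan *)

Lemma GO_eq P (a b : GO P) : proj1_sig a = proj1_sig b -> a = b.
Proof. destruct a, b; apply subset_eq_compat. Qed.

Lemma anc_GO P n (a : GO P) :
  proj1_sig (anc (GammaOmega P) n a) = firstn (length (proj1_sig a) - n) (proj1_sig a).
Proof.
  induction n as [|n IH]; [simpl; now rewrite Nat.sub_0_r, firstn_all|].
  unfold anc in *; rewrite Nat.iter_succ; simpl; simpl in IH; rewrite IH.
  rewrite firstn_firstn, length_firstn; f_equal; lia.
Qed.

Lemma lcp_prefix_r s t : exists u, t = lcp s t ++ u.
Proof.
  revert t; induction s as [|x s IH]; intros [|y t]; simpl; eauto.
  destruct (entry_eq_dec x y) as [->|]; simpl; eauto.
  destruct (IH t) as [u Hu]; exists u; congruence.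
Qed.

Lemma lcp_app c s t : lcp (c ++ s) (c ++ t) = c ++ lcp s t.
Proof.
  induction c as [|x c IH]; simpl; auto.
  destruct (entry_eq_dec x x); congruence.
Qed.

Lemma GO_finite_height P : finite_height_tree (GammaOmega P).
Proof.
  split.
  - intros a b [u Hu] [w Hw]; apply GO_eq; pose proof Hu as L.
    rewrite Hw, <- app_assoc in L; apply (f_equal (@length _)) in L.
    rewrite !length_app in L; destruct w; [now rewrite app_nil_r in Hw|simpl in L; lia].
  - intros a b; split.
    + intros [u Hu]; exists (length u); apply GO_eq; rewrite anc_GO, Hu, length_app.
      rewrite Nat.add_sub, firstn_app, Nat.sub_diag, firstn_all; simpl; apply app_nil_r.
    + intros [n <-]; exists (skipn (length (proj1_sig b) - n) (proj1_sig b)).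
      now rewrite anc_GO, firstn_skipn.
  - intros a b; simpl; unfold GO_le, GO_meet; simpl; rewrite <- lcp_firstn.
    split; [|split].
    + exists (skipn (length (lcp (proj1_sig a) (proj1_sig b))) (proj1_sig a)).
      rewrite lcp_firstn at 1; now rewrite firstn_skipn.
    + apply lcp_prefix_r.
    + intros c [u Hu] [w Hw]; rewrite Hu, Hw, lcp_app; eauto.
  - apply GO_eq; auto.
  - intros a; exists (length (proj1_sig a)); apply GO_eq; now rewrite anc_GO, Nat.sub_diag.
Qed.

Lemma child_GO P (y a : GO P) :
  child (GammaOmega P) y a <-> exists e, proj1_sig y = proj1_sig a ++ [e].
Proof.
  assert (F : forall (s : list entry) e, firstn (Nat.pred (length (s ++ [e]))) (s ++ [e]) = s).
  { intros s e; rewrite length_app, Nat.add_1_r; simpl.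
    rewrite firstn_app, Nat.sub_diag, firstn_all; apply app_nil_r. }
  split.
  - intros [H1 H2]; apply (f_equal (@proj1_sig _ _)) in H2; simpl in H2.
    destruct (exists_last (l := proj1_sig y)) as [s [e E]].
    + intros E; apply H1, GO_eq, E.
    + exists e; rewrite <- H2, E, F; auto.
  - intros [e E]; split.
    + intros ->; simpl in E; destruct (proj1_sig a); discriminate.
    + apply GO_eq; simpl; rewrite E; apply F.
Qed.

Section Plan.

Variables (mult : nat -> nat -> option nat) (K r : nat).
Hypothesis mult_bound : forall s t, K <= t -> mult s t = Some 0.

Definition width (m : option nat) : nat := match m with Some n => n | None => 1 end.

(* The index [to_nat (t, j)] stands for the [j]-th child of type [t]; for an
   infinite multiplicity only [j = 0] occurs, with lambda = oo. *)
Definition allowed (s i : nat) : Prop :=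
  snd (of_nat i) < width (mult s (fst (of_nat i))).

(** The set of sequences of the plan will be the valid ones from the root type [r]. Each index
    carries the type of the node it leads to. *)
Fixpoint valid (s : nat) (l : list nat) : Prop :=
  match l with [] => True | i :: l => allowed s i /\ valid (fst (of_nat i)) l end.

Definition type_at (s : nat) (l : list nat) : nat := fold_left (fun _ i => fst (of_nat i)) l s.

Lemma valid_app s l l' : valid s (l ++ l') <-> valid s l /\ valid (type_at s l) l'.
Proof.
  revert s; induction l as [|i l IH]; intros s; simpl; [tauto|]; rewrite IH; simpl; tauto.
Qed.

Lemma type_at_snoc s l i : type_at s (l ++ [i]) = fst (of_nat i).
Proof. unfold type_at; now rewrite fold_left_app. Qed.

Lemma allowed_finite s : exists L, forall i, In i L <-> allowed s i.
Proof.
  exists (flat_map (fun t => map (fun j => to_nat (t, j)) (seq 0 (width (mult s t)))) (seq 0 K)).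
  intros i; rewrite in_flat_map; unfold allowed; split.
  - intros [t [_ H]]; apply in_map_iff in H; destruct H as [j [<- H]].
    rewrite cancel_of_to; apply in_seq in H; simpl; lia.
  - intros H; exists (fst (of_nat i)); split.
    + apply in_seq; destruct (le_lt_dec K (fst (of_nat i))) as [L|L]; [|lia].
      rewrite mult_bound in H by auto; simpl in H; lia.
    + apply in_map_iff; exists (snd (of_nat i)); split; [|apply in_seq; lia].
      rewrite <- surjective_pairing; apply cancel_to_of.
Qed.

(** Finite branching, from [allowed_finite], together with bounded length; the induction is on the
    bound. *)
Lemma valid_finite h : forall s, (forall l, valid s l -> length l <= h) ->
  exists L, forall l, In l L <-> valid s l.
Proof.
  induction h as [|h IH]; intros s Hs.
  - exists [[]]; intros l; simpl; split; [intros [<-|[]]; simpl; auto|].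
    intros Hl; apply Hs in Hl; destruct l; simpl in Hl; [auto|lia].
  - assert (X : forall i, {L | allowed s i -> forall l, In l L <-> valid (fst (of_nat i)) l}).
    { intros i; apply constructive_indefinite_description.
      destruct (classic (allowed s i)) as [A|A]; [|exists []; tauto].
      destruct (IH (fst (of_nat i))) as [L HL]; [|exists L; auto].
      intros l Hl; apply le_S_n, (Hs (i :: l)); simpl; auto. }
    destruct (allowed_finite s) as [I HI].
    exists ([] :: flat_map (fun i => map (cons i) (proj1_sig (X i))) I).
    intros [|i l]; simpl; [tauto|]; rewrite in_flat_map; split.
    + intros [E|[j [Hj H]]]; [discriminate|]; apply in_map_iff in H.
      destruct H as [l' [E H]]; injection E as -> ->; apply HI in Hj; split; auto.
      destruct (X i) as [L HL]; apply HL in H; auto.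
    + intros [A H]; right; exists i; split; [apply HI; auto|]; apply in_map.
      destruct (X i) as [L HL]; apply HL; auto.
Qed.

(** Reversal exposes the last index: lambda is oo exactly when its type has infinite multiplicity
    below the type reached just before. *)
Definition plan_lam (l : list nat) : bool :=
  match rev l with
  | [] => false
  | i :: l' => match mult (type_at r (rev l')) (fst (of_nat i)) with
               | Some _ => false | None => true end
  end.

Variable G : list (list nat).
Hypothesis G_valid : forall l, In l G <-> valid r l.

Lemma plan_nil : In [] G.
Proof. apply G_valid; simpl; auto. Qed.

Lemma plan_prefix s k : In s G -> In (firstn k s) G.
Proof.
  rewrite !G_valid; intros H; rewrite <- (firstn_skipn k s) in H.
  apply valid_app in H; tauto.
Qed.

Definition plan : TreePlan := mkTreePlan G plan_lam plan_nil plan_prefix eq_refl.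

Lemma inGO_snoc s e : inGO plan (s ++ [e]) <->
  inGO plan s /\ allowed (type_at r (map fst s)) (fst e) /\
  match mult (type_at r (map fst s)) (fst (of_nat (fst e))) with
  | Some _ => snd e = None | None => exists n, snd e = Some n end.
Proof.
  unfold inGO, entry in *; rewrite map_app, length_app; cbn [map length gam lam plan].
  rewrite !G_valid, valid_app; cbn [valid].
  assert (E1 : forall k, k < length s ->
     firstn (S k) (map fst s ++ [fst e]) = firstn (S k) (map fst s) /\
     nth k (s ++ [e]) (0, None) = nth k s (0, None)).
  { intros k Hk; split; [|apply app_nth1, Hk].
    rewrite firstn_app, (proj2 (Nat.sub_0_le _ _)); [apply app_nil_r|].
    rewrite length_map; exact Hk. }
  assert (E2 : firstn (S (length s)) (map fst s ++ [fst e]) = map fst s ++ [fst e] /\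
     nth (length s) (s ++ [e]) (0, None) = e).
  { split; [|apply nth_middle]; apply firstn_all2; rewrite length_app, length_map, Nat.add_1_r; apply le_n. }
  assert (E3 : plan_lam (map fst s ++ [fst e]) =
    match mult (type_at r (map fst s)) (fst (of_nat (fst e))) with
    | Some _ => false | None => true end).
  { unfold plan_lam; rewrite rev_app_distr; simpl; now rewrite rev_involutive. }
  split.
  - intros [[V1 [V2 _]] H]; split; [split; auto|split; auto].
    + intros k Hk; destruct (E1 k Hk) as [E4 E5]; rewrite <- E4, <- E5; apply H; lia.
    + destruct E2 as [E4 E5]; specialize (H (length s)); rewrite E4, E5, E3 in H.
      destruct (mult (type_at r (map fst s)) (fst (of_nat (fst e)))); apply H; auto; lia.
  - intros [[V1 H] [V2 H2]]; split; [auto|]; intros k Hk.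
    destruct (Nat.eq_dec k (length s)) as [->|N].
    + destruct E2 as [-> ->]; rewrite E3.
      destruct (mult (type_at r (map fst s)) (fst (of_nat (fst e)))); split; auto; discriminate.
    + destruct (E1 k) as [-> ->]; [lia|]; apply H; lia.
Qed.

Definition GO_type (a : GO plan) : nat := type_at r (map fst (proj1_sig a)).

(** Elements with different values of [g] differ. The bound [g y < n] is added to keep the next
    element out of the list. *)
Lemma nodup_of_indexed {X : Type} (Q : X -> Prop) (g : X -> nat) n :
  (forall j, j < n -> exists y, Q y /\ g y = j) ->
  exists ys, length ys = n /\ NoDup ys /\ forall y, In y ys -> Q y.
Proof.
  intros H.
  enough (E : exists ys, length ys = n /\ NoDup ys /\ forall y, In y ys -> Q y /\ g y < n)
    by (destruct E as [ys [H1 [H2 H3]]]; exists ys; split; [|split]; auto; intros; apply H3; auto).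
  induction n as [|n IH]; [exists []; split; [|split]; [auto|constructor|intros y []]|].
  destruct IH as [ys [H1 [H2 H3]]]; [intros; apply H; lia|].
  destruct (H n) as [y [Hy1 Hy2]]; [lia|]; exists (y :: ys); split; [simpl; auto|split].
  - constructor; auto; intros Hy; apply H3 in Hy; lia.
  - intros z [<-|Hz]; [split; auto; lia|]; destruct (H3 z Hz); split; auto; lia.
Qed.

Lemma child_GO_type (y a : GO plan) e :
  proj1_sig y = proj1_sig a ++ [e] -> GO_type y = fst (of_nat (fst e)).
Proof. intros E; unfold GO_type; rewrite E, map_app; apply type_at_snoc. Qed.

(** For finite multiplicity [k] the children of type [t] have last entry [(to_nat (t, j), None)]
    with [j < k]; for infinite multiplicity it is [(to_nat (t, 0), Some m)] with [m] any number. *)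
Lemma GO_has_multiplicities : has_multiplicities (GammaOmega plan) GO_type mult.
Proof.
  intros a t n.
  assert (new : forall j o, j < width (mult (GO_type a) t) ->
    match mult (GO_type a) t with Some _ => o = None | None => exists n, o = Some n end ->
    exists y : GO plan, (child (GammaOmega plan) y a /\ GO_type y = t) /\
      last (proj1_sig y) (0, None) = (to_nat (t, j), o)).
  { intros j o Hj Ho.
    assert (I : inGO plan (proj1_sig a ++ [(to_nat (t, j), o)])).
    { apply inGO_snoc; unfold allowed; cbn [fst snd]; rewrite cancel_of_to; cbn [fst snd].
      split; [exact (proj2_sig a)|split; auto]. }
    exists (exist _ _ I); split; [split|].
    - apply child_GO; simpl; eauto.
    - rewrite (child_GO_type _ a (to_nat (t, j), o)) by auto; cbn [fst]; now rewrite cancel_of_to.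
    - apply last_last. }
  split.
  - intros [ys [<- [N H]]]; destruct (mult (GO_type a) t) as [k|] eqn:Em; [simpl|exact I].
    assert (Hy : forall y, In y ys -> exists i,
      proj1_sig y = proj1_sig a ++ [(i, None)] /\ fst (of_nat i) = t /\ snd (of_nat i) < k).
    { intros y Hy; destruct (H y Hy) as [C T]; apply child_GO in C; destruct C as [[i o] E].
      rewrite (child_GO_type _ _ _ E) in T; cbn [fst] in T.
      pose proof (proj2_sig y) as Iy; simpl in Iy; rewrite E in Iy; apply inGO_snoc in Iy.
      unfold allowed in Iy; cbn [fst snd] in Iy; fold (GO_type a) in Iy; rewrite T, Em in Iy.
      destruct Iy as [_ [I1 ->]]; exists i; auto. }
    (* With [t] fixed and the second component [None], the number [j] determines the child, so [g]
       embeds [ys] into the numbers below [k]. *)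
    set (g := fun y : GO plan => snd (of_nat (fst (last (proj1_sig y) (0, None))))).
    rewrite <- (length_map g ys), <- (length_seq k 0); apply NoDup_incl_length.
    + apply NoDup_map_NoDup_ForallPairs; auto; intros y y' Iy Iy' E.
      destruct (Hy y Iy) as [i [E1 [E2 E3]]], (Hy y' Iy') as [i' [E1' [E2' E3']]].
      unfold g in E; rewrite E1, E1', !last_last in E; cbn [fst] in E.
      apply GO_eq; rewrite E1, E1'; do 3 f_equal; rewrite <- (cancel_to_of i), <- (cancel_to_of i').
      f_equal; rewrite (surjective_pairing (of_nat i)), (surjective_pairing (of_nat i')); congruence.
    + intros j Hj; apply in_map_iff in Hj; destruct Hj as [y [<- Iy]].
      destruct (Hy y Iy) as [i [E1 [E2 E3]]]; unfold g; rewrite E1, last_last; apply in_seq.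
      simpl; lia.
  - intros L; destruct (mult (GO_type a) t) as [k|] eqn:Em; simpl in L; cbn [width] in new.
    + apply (nodup_of_indexed _ (fun y : GO plan => snd (of_nat (fst (last (proj1_sig y) (0, None)))))).
      intros j Hj; destruct (new j None) as [y [H1 H2]]; auto; [lia|].
      exists y; split; auto; rewrite H2; cbn [fst]; now rewrite cancel_of_to.
    (* Here the index is always [to_nat (t, 0)] and the children are told apart by their copy
       number. *)
    + apply (nodup_of_indexed _ (fun y : GO plan =>
        match snd (last (proj1_sig y) (0, None)) with Some m => m | None => 0 end)).
      intros j Hj; destruct (new 0 (Some j)) as [y [H1 H2]]; eauto.
      exists y; split; auto; now rewrite H2.
Qed.

End Plan.

(** An allowed index has positive width, so its type occurs among the children and the path can be
    followed in [M]. This bounds the length of valid sequences by the height of [M]. *)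
Lemma valid_realized M ty mult : has_multiplicities M ty mult ->
  forall l, valid mult (ty (lt_eps M)) l ->
  exists a, ty a = type_at (ty (lt_eps M)) l /\
    forall j, j < length l -> anc M j a <> lt_eps M.
Proof.
  intros HM; induction l as [|i l IH] using rev_ind; intros V.
  - exists (lt_eps M); split; auto; simpl; lia.
  - apply valid_app in V; destruct V as [V [A _]]; destruct (IH V) as [a [H1 H2]].
    assert (C : children_ge M ty a (fst (of_nat i)) 1).
    { apply HM; rewrite H1; unfold allowed in A.
      destruct (mult _ (fst (of_nat i))); simpl in *; lia || auto. }
    destruct C as [[|c ys] [L [_ H]]]; [discriminate|].
    destruct (H c (or_introl eq_refl)) as [[C1 C2] C3]; exists c; split.
    + now rewrite type_at_snoc.
    + rewrite length_app; simpl; intros [|j] Hj; [exact C1|].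
      unfold anc; rewrite Nat.iter_succ_r, C2; apply H2; lia.
Qed.

Theorem mainTheorem13 (M : LtStr) :
  is_tree M ->
  (finite_str M \/ (~ finite_str M /\ Th_aleph0_categorical M)) ->
  exists P : TreePlan, same_theory M (GammaOmega P).
Proof.
  intros HT HM; apply tree_finite_height in HT.
  assert (HF : finitely_many_types M FTrue).
  { destruct HM as [H|[H1 H2]];
      [apply finite_finitely_many_types|apply categorical_finitely_many_types]; auto. }
  destruct (finitely_many_types_bounded_height M HT HF) as [H Hbound].
  destruct (finitely_many_types_multiplicities M HF) as [ty [K [mult [Hm HK]]]].
  destruct (valid_finite mult K HK H (ty (lt_eps M))) as [G HG].
  (* A valid sequence longer than [H] would be realized by a node that [H] predecessor steps do not
     bring to the root. *)
  { intros l Hl; destruct (valid_realized M ty mult Hm l Hl) as [a [_ Ha]].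
    apply Nat.nlt_ge; intros L; exact (Ha H L (Hbound a)). }
  exists (plan mult (ty (lt_eps M)) G HG).
  apply (same_multiplicities_same_theory M (GammaOmega _) ty (GO_type mult _ G HG) mult);
    auto using GO_finite_height, GO_has_multiplicities.
Qed.
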